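(* Let $P=(P_1,P_2)$ be an admissible polynomial $2$-tuple and let $m=(m_1,m_2)\in\mathbb N^2$. Consider the sequences $$a_{P_1,m_1}(k)=\frac{A_{P_1,m_1}(k\varepsilon_1)}{A_{P_1,m_1}((k+1)\varepsilon_1)},\qquad a_{P_2,m_2}(k)=\frac{A_{P_2,m_2}(k\varepsilon_2)}{A_{P_2,m_2}((k+1)\varepsilon_2)},\qquad k\in\mathbb Z_+.$$ If $\mathscr M_z$ is the multiplication $2$-tuple on $\mathscr H^2_m(\triangle^2_P)$, then: (i) $\det[\mathscr M_z^*,\mathscr M_z]$ is positive if and only if the sequences $a_{P_1,m_1}$ and $a_{P_2,m_2}$ are increasing; (ii) if $\det[\mathscr M_z^*,\mathscr M_z]$ is positive, then $\det[\mathscr M_z^*,\mathscr M_z]$ is of trace class if and only if the sequences $a_{P_1,m_1}$ and $a_{P_2,m_2}$ are bounded; (iii) if the sequences $a_{P_1,m_1}$ and $a_{P_2,m_2}$ are bounded and increasing, then $$\mathrm{trace}\big(\det[\mathscr M_z^*,\mathscr M_z]\big)=\lim_{k\to\infty}a_{P_1,m_1}(k)\Big(\lim_{l\to\infty}a_{P_2,m_2}(l)\Big)^2.$$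
   Context: $\mathbb N$ = positive integers, $\mathbb Z_+$ = nonnegative integers, $\varepsilon_1=(1,0)$, $\varepsilon_2=(0,1)$, $\mathbb C_*=\mathbb C\setminus\{0\}$. ''Positive'' means positive semi-definite; ''increasing'' means non-decreasing. An admissible polynomial $2$-tuple is a pair $P=(P_1,P_2)$ of polynomials in $z_1,z_2$ with nonnegative coefficients such that $P_j$ has zero constant term, linear part $a_jz_j$ with $a_j>0$, and $P_j$ depends on $z_j$ alone ($j=1,2$). Define $A_{P_j,m_j}(\alpha)$, $\alpha\in\mathbb Z_+^2$, by $(1-P_j(z))^{-m_j}=\sum_{\alpha\in\mathbb Z_+^2}A_{P_j,m_j}(\alpha)z^\alpha$ near the origin. Let $\varphi(z)=(z_1/z_2,z_2)$ on $\mathbb C\times\mathbb C_*$, let $z\diamond w=(z_1w_1,z_2w_2)$, and let $\triangle^2_P=\{z\in\mathbb C\times\mathbb C_*:P_j(\varphi(z)\diamond\overline{\varphi(z)})<1,\ j=1,2\}$. $\mathscr H^2_m(\triangle^2_P)$ is the reproducing kernel Hilbert space of holomorphic functions on $\triangle^2_P$ with kernel $$\mathscr K_{P,m}(z,w)=\frac1{z_2\overline w_2}\prod_{j=1}^2\frac1{\big(1-P_j(\varphi(z)\diamond\overline{\varphi(w)})\big)^{m_j}}.$$ $z_1,z_2$ are multipliers and $\mathscr M_z=(\mathscr M_{z_1},\mathscr M_{z_2})$ consists of the bounded multiplication operators. With $[A,B]=AB-BA$, the determinant operator of a commuting pair $T=(T_1,T_2)$ is $$\det[T^*,T]=[T_1^*,T_1][T_2^*,T_2]+[T_2^*,T_2][T_1^*,T_1]-[T_1^*,T_2][T_2^*,T_1]-[T_2^*,T_1][T_1^*,T_2].$$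 *)

(* Defs.v *)
From HB Require Import structures.
From mathcomp Require Import all_boot all_order all_algebra.
From mathcomp Require Import all_classical all_reals all_analysis.
From mathcomp Require Import sesquilinear complex.
(* mpoly is not fully imported: its notations clash with those of analysis. *)
From mathcomp Require Import (coercions, canonicals) mpoly.

Set Implicit Arguments.
Unset Strict Implicit.
Unset Printing Implicit Defensive.

Import Order.TTheory GRing.Theory Num.Theory numFieldNormedType.Exports.

Local Open Scope classical_set_scope.
Local Open Scope complex_scope.
Local Open Scope ring_scope.

(* R[i] bundled as a numClosedFieldType, so that the topology and the norm that
   analysis attaches to numeric fields are found on it. The order of this field
   is the partial one: [0 <= x] says that x is real and nonnegative. *)
Definition CC (R : realType) : numClosedFieldType := R[i].

Definition RtoC (R : realType) (r : R) : CC R := r%:C.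

Notation mindex := (mpoly.multinom 2).

Section Operators.
Context {R : realType} {H : completeNormedModType (CC R)}.

(* Linear in the first argument, as all {dot _ for _} forms. With this
   hypothesis the complete normed space H is a Hilbert space for dot. *)
Definition inner_product_norm (dot : {dot H for Num.conj}) :=
  forall f, dot f f = `|f| ^+ 2.

Variable dot : {dot H for Num.conj}.

Definition bounded_op (T : H -> H) :=
  linear T /\ exists B : R, forall f, `|T f| <= RtoC B * `|f|.

Definition is_adjoint (T S : H -> H) := forall f g, dot (T f) g = dot f (S g).

(* Junk value (the zero map) when T has no adjoint; adjoints are unique. *)
Definition adjoint (T : H -> H) : H -> H :=
  xget (fun=> 0) [set S | is_adjoint T S].

Definition commutator (A B : H -> H) : H -> H := (A \o B) \- (B \o A).

Definition det_op (T1 T2 : H -> H) : H -> H :=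
  let T1s := adjoint T1 in let T2s := adjoint T2 in
  (((commutator T1s T1 \o commutator T2s T2)
    \+ (commutator T2s T2 \o commutator T1s T1))
    \- (commutator T1s T2 \o commutator T2s T1))
    \- (commutator T2s T1 \o commutator T1s T2).

Definition positive_op (T : H -> H) := forall f, 0 <= dot (T f) f.

(* Orthonormal bases of a separable infinite-dimensional space. *)
Definition orthonormal_basis (e : nat -> H) :=
  (forall i j, dot (e i) (e j) = (i == j)%:R) /\
  (forall f, (forall n, dot f (e n) = 0) -> f = 0).

(* S is the absolute value |T|, the positive square root of T^* T. *)
Definition is_abs_op (T S : H -> H) :=
  [/\ bounded_op S, positive_op S & S \o S = adjoint T \o T].

Definition trace_class (T : H -> H) :=
  bounded_op T /\
  exists2 S, is_abs_op T S &
  exists2 e, orthonormal_basis e &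
    cvgn (series (fun n => dot (S (e n)) (e n))).

Definition is_trace (T : H -> H) (t : CC R) :=
  trace_class T /\
  forall e, orthonormal_basis e ->
    series (fun n => dot (T (e n)) (e n)) @ \oo --> t.

End Operators.

(* A reproducing kernel Hilbert space of holomorphic functions on D with kernel
   K. Its elements are abstract; rkhs_eval identifies them with functions on D
   (by rkhs_eval_inj; values outside D are junk). *)
Record rkhs (R : realType) (D : set 'rV[CC R]_2)
    (K : 'rV[CC R]_2 -> 'rV[CC R]_2 -> CC R) := Rkhs {
  rkhs_space :> completeNormedModType (CC R);
  rkhs_dot : {dot rkhs_space for Num.conj};
  rkhs_eval : rkhs_space -> 'rV[CC R]_2 -> CC R;
  rkhs_norm : inner_product_norm rkhs_dot;
  rkhs_eval_linear : forall (a : CC R) (f g : rkhs_space) z, D z ->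
        rkhs_eval (a *: f + g) z = a * rkhs_eval f z + rkhs_eval g z;
  rkhs_eval_inj : forall f : rkhs_space,
        (forall z, D z -> rkhs_eval f z = 0) -> f = 0;
  rkhs_holomorphic : forall (f : rkhs_space) z, D z ->
        differentiable (rkhs_eval f) z;
  rkhs_reproducing : forall w, D w -> exists kw : rkhs_space,
        (forall z, D z -> rkhs_eval kw z = K z w) /\
        (forall f, rkhs_eval f w = rkhs_dot f kw) }.

Definition is_multiplication_op (R : realType) (D : set 'rV[CC R]_2)
    (K : 'rV[CC R]_2 -> 'rV[CC R]_2 -> CC R) (H : rkhs D K)
    (psi : 'rV[CC R]_2 -> CC R) (M : H -> H) :=
  bounded_op M /\
  forall f z, D z -> rkhs_eval (M f) z = psi z * rkhs_eval f z.

Section HartogsTriangle.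
Variable R : realType.
Local Notation C := (CC R).
Implicit Types (p : mpoly.mpoly 2 R) (P : 'I_2 -> mpoly.mpoly 2 R).
Implicit Types (m : 'I_2 -> nat) (z w : 'rV[C]_2).

(* Indices 0 and 1 of 'I_2 stand for 1 and 2. *)
Definition admissible P := forall j : 'I_2,
  [/\ forall al, 0 <= mpoly.mcoeff al (P j),
      mpoly.mcoeff (@mpoly.mnm0 2) (P j) = 0,
      0 < mpoly.mcoeff (mpoly.mnm1 j) (P j),
      forall i, i != j -> mpoly.mcoeff (mpoly.mnm1 i) (P j) = 0 &
      forall al i, mpoly.mcoeff al (P j) != 0 -> i != j -> al i = 0%N].

Definition peval p z : C := mpoly.mmap (@RtoC R) (fun i => z 0 i) p.

Definition monomial z (al : mindex) : C := \prod_(i < 2) z 0 i ^+ al i.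

(* (1 - p z)^-n = \sum_al A al * z^al near the origin, the double series being
   absolutely convergent and summed by total degree. *)
Definition is_expansion p (n : nat) (A : mindex -> R) :=
  exists2 r : R, 0 < r & forall z, (forall i, `|z 0 i| < RtoC r) ->
    cvgn (fun N => \sum_(al : mpoly.bmultinom 2 N)
                     `|RtoC (A al) * monomial z al| : C) /\
    (fun N => \sum_(al : mpoly.bmultinom 2 N)
                RtoC (A al) * monomial z al : C) @ \oo
      --> (1 - peval p z) ^- n.

(* mnm_muln (mnm1 j) k is the multi-index k eps_j. *)
Definition coef_ratio (j : 'I_2) (A : mindex -> R) (k : nat) : R :=
  A (mpoly.mnm_muln (mpoly.mnm1 j) k) / A (mpoly.mnm_muln (mpoly.mnm1 j) k.+1).

Definition phi z : 'rV[C]_2 :=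
  \row_j (if j == 0 then z 0 0 / z 0 1 else z 0 1).

Definition mul_conj z w : 'rV[C]_2 := \row_j (z 0 j * (w 0 j)^*).

Definition hartogs_triangle P : set 'rV[C]_2 :=
  [set z : 'rV[C]_2 | z 0 1 != 0 /\
    forall j, peval (P j) (mul_conj (phi z) (phi z)) < 1].

Definition hartogs_kernel P m z w : C :=
  (z 0 1 * (w 0 1)^*)^-1 *
  \prod_(j < 2) (1 - peval (P j) (mul_conj (phi z) (phi w))) ^- m j.

End HartogsTriangle.

(* Main.v *)
(** With u1 = z1/z2, u2 = z2 and v1 = w1/w2, v2 = w2 the kernel is (z2 conj w2)^-1
    times the double power series with coefficients A1(k) A2(l) in u1 conj v1 and
    u2 conj v2, so the
    functions f_kl = u1^k u2^l / z2 are an orthogonal basis of the space, with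
    |f_kl|^2 = 1 / (A1(k) A2(l)). They lie in the abstract space as limits of
    averages of kernel vectors over roots of unity (discrete Cauchy integrals on a
    small torus), and they are complete since the partial sums of the expansion of
    a kernel vector converge to it in norm.

    As z1 f_kl = f_(k+1,l+1) and z2 f_kl = f_(k,l+1), the adjoints are backward
    shifts with weights a1(k-1) a2(l-1) and a2(l-1), and the determinant operator is
    diagonal with eigenvalues (a1(k) - a1(k-1)) (a2(l)^2 - a2(l-1)^2), where
    a1(-1) = a2(-1) = 0. Their signs give the positivity criterion, and their double
    sum telescopes to the trace. The two ratio sequences are always bounded, because
    the multiplication operators are. *)

(* The Hilbert space is abstract: its only explicit elements are the kernel vectors, so the [f_kl],
   their inner products and their completeness must all be extracted from the kernel. Averages over
   roots of unity are finite sums, and their error is the tail of an absolutely convergent series,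
   uniform on a disc. Two points about the coefficients are delicate. The expansion is given only
   near the origin, whereas completeness needs it at every point of the domain; the coefficients are
   therefore identified with those of powers of truncated geometric sums, whose nonnegativity gives
   convergence at every nonnegative argument where the polynomial is below 1. And the torus must be
   so small that each product of a domain coordinate with a torus coordinate stays in the disc of
   the given expansion. The operator theory reduces to real series with nonnegative terms, for which
   the enumeration of pairs and the orthonormal basis may be changed freely. In (ii), positivity
   already makes both sides of the equivalence true. *)
Require Import Defs.
From HB Require Import structures.
From mathcomp Require Import all_boot all_order all_algebra.
From mathcomp Require Import all_classical all_reals all_analysis.
From mathcomp Require Import sesquilinear complex ring zify.
From mathcomp Require cyclic cyclotomic separable.
From mathcomp Require Import (coercions, canonicals) mpoly.

Import Order.TTheory GRing.Theory Num.Theory numFieldNormedType.Exports.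

Local Open Scope classical_set_scope.
Local Open Scope ring_scope.

Set Implicit Arguments.
Unset Strict Implicit.
Unset Printing Implicit Defensive.

(** * Reals in the complex field *)

Section RealsInComplex.
Context {R : realType}.
Implicit Types (x y : R) (z : CC R).

Lemma RtoC_is_rmorphism : GRing.zmod_morphism (@RtoC R) * GRing.monoid_morphism (@RtoC R).
Proof.
by split; [exact: (rmorphB (real_complex R)) | split; [exact: rmorph1 (real_complex R)|exact: (rmorphM (real_complex R))]].
Qed.

HB.instance Definition _ := GRing.isZmodMorphism.Build R (CC R) (@RtoC R) RtoC_is_rmorphism.1.
HB.instance Definition _ := GRing.isMonoidMorphism.Build R (CC R) (@RtoC R) RtoC_is_rmorphism.2.

Lemma ler_RtoC x y : (RtoC x <= RtoC y) = (x <= y).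
Proof. exact: lecR. Qed.

Lemma ltr_RtoC x y : (RtoC x < RtoC y) = (x < y).
Proof. exact: ltcR. Qed.

Lemma RtoC_ge0 x : (0 <= RtoC x) = (0 <= x).
Proof. exact: ler0c. Qed.

Lemma RtoC_gt0 x : (0 < RtoC x) = (0 < x).
Proof. by rewrite -(ltr_RtoC 0 x). Qed.

Lemma RtoC_inj : injective (@RtoC R).
Proof. by move=> x y []. Qed.

Lemma RtoC_eq0 x : (RtoC x == 0) = (x == 0).
Proof. by apply/eqP/eqP => [/RtoC_inj|->]. Qed.

Lemma normr_RtoC x : `|RtoC x| = RtoC `|x|.
Proof. by rewrite /RtoC normc_def /= expr0n /= addr0 sqrtr_sqr. Qed.

Lemma conjC_RtoC x : (RtoC x)^* = RtoC x.
Proof. exact: conjc_real. Qed.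

Definition Creal z : R := complex.Re z.

Lemma CrealK z : 0 <= z -> RtoC (Creal z) = z.
Proof. by move=> z0; apply: RRe_real; rewrite realE z0. Qed.

Lemma Creal_RtoC x : Creal (RtoC x) = x.
Proof. by []. Qed.

Lemma Creal_gt0 z : 0 < z -> 0 < Creal z.
Proof. by move=> z0; rewrite -RtoC_gt0 CrealK// ltW. Qed.

Lemma Creal_ge0 z : 0 <= z -> 0 <= Creal z.
Proof. by move=> z0; rewrite -RtoC_ge0 CrealK. Qed.

Lemma norm_Creal_le z : RtoC `|Creal z| <= `|z|.
Proof. exact: normc_ge_Re. Qed.

Lemma cvg_RtoC (T : Type) (F : set_system T) {FF : Filter F} (u : T -> R) x :
  (RtoC (u t) @[t --> F] --> RtoC x) <-> (u t @[t --> F] --> x).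
Proof.
split=> /cvgrPdist_lt h; apply/cvgrPdist_lt => e e0.
  have := h (RtoC e); rewrite RtoC_gt0 => /(_ e0); apply: filterS => t.
  by rewrite -rmorphB normr_RtoC ltr_RtoC.
have := h (Creal e) (Creal_gt0 e0); apply: filterS => t.
by rewrite -rmorphB normr_RtoC -{2}(CrealK (ltW e0)) ltr_RtoC.
Qed.

Lemma cvg_seriesRtoC (u : R ^nat) (x : R) :
  (series (fun n => RtoC (u n)) @ \oo --> RtoC x) <-> (series u @ \oo --> x).
Proof.
have -> : series (fun n => RtoC (u n)) = (fun n => RtoC (series u n)).
  by apply/funext => n; rewrite /series /= rmorph_sum.
exact: cvg_RtoC.
Qed.

(** The complex limit is not known in advance to be real, so the forward direction passes through
    Cauchy sequences: taking real parts does not increase distances. *)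
Lemma is_cvg_RtoC (u : R ^nat) : cvgn (fun n => RtoC (u n)) <-> cvgn u.
Proof.
split; last by move=> /cvg_ex[l ul]; apply/cvg_ex; exists (RtoC l); exact/cvg_RtoC.
move=> /cvg_cauchy/cauchyP h.
apply/cauchy_cvgP/cauchyP => e e0.
have [|z hz] := h (RtoC e); first by rewrite RtoC_gt0.
exists (Creal z).
have {}hz : \forall n \near \oo, ball z (RtoC e) (RtoC (u n)) by exact: hz.
suff : \forall n \near \oo, ball (Creal z) e (u n) by [].
move: hz; apply: filterS => n; rewrite -!ball_normE /=.
move=> zn; rewrite -ltr_RtoC; apply: le_lt_trans zn.
rewrite -[u n]Creal_RtoC -(raddfB (@complex.Re R)).
exact: norm_Creal_le.
Qed.

Lemma cvgC_unique (u : nat -> CC R) (a b : CC R) :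
  u n @[n --> \oo] --> a -> u n @[n --> \oo] --> b -> a = b.
Proof. by move=> ua ub; apply: cvg_unique ua ub; exact: norm_hausdorff. Qed.

Lemma lipschitz_cvg (V W : normedModType (CC R)) (T : Type) (F : set_system T)
    {FF : Filter F} (h : V -> W) (B : CC R) (u : T -> V) (a : V) :
  0 <= B -> (forall f g, `|h f - h g| <= B * `|f - g|) ->
  u t @[t --> F] --> a -> h (u t) @[t --> F] --> h a.
Proof.
move=> B0 hB /cvgrPdist_lt ua; apply/cvgrPdist_lt => e e0.
have B1 : 0 < B + 1 by rewrite ltr_wpDl.
have := ua (e / (B + 1)); rewrite divr_gt0// => /(_ isT); apply: filterS => t.
rewrite ltr_pdivlMr// => ut; apply: le_lt_trans ut; apply: (le_trans (hB _ _)).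
by rewrite mulrC ler_wpM2l// lerDl.
Qed.

End RealsInComplex.

(** * Hilbert spaces with an orthonormal basis *)

Section Hilbert.
Context {R : realType} {H : completeNormedModType (CC R)}.
Variable dot : {dot H for Num.conj}.
Hypothesis dot_norm : inner_product_norm dot.
Implicit Types (f g h : H) (a b : CC R) (S T : H -> H).

Lemma dotC f g : dot f g = (dot g f)^*.
Proof. by rewrite hermC expr0 mul1r. Qed.

Lemma dotDr f g h : dot f (g + h) = dot f g + dot f h.
Proof. exact: linearDr. Qed.

Lemma dotBl f g h : dot (f - g) h = dot f h - dot g h.
Proof. exact: linearBl. Qed.

Lemma dotBr f g h : dot f (g - h) = dot f g - dot f h.
Proof. exact: linearBr. Qed.

Lemma dotZl a f g : dot (a *: f) g = a * dot f g.
Proof. exact: linearZl_LR. Qed.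

Lemma dotZr a f g : dot f (a *: g) = a^* * dot f g.
Proof. exact: linearZr_LR. Qed.

Lemma dot0l f : dot 0 f = 0.
Proof. exact: linear0l. Qed.

Lemma dot0r f : dot f 0 = 0.
Proof. exact: linear0r. Qed.

Lemma dot_suml (I : Type) (r : seq I) (P : pred I) (u : I -> H) f :
  dot (\sum_(i <- r | P i) u i) f = \sum_(i <- r | P i) dot (u i) f.
Proof. exact: linear_sumlz. Qed.

Lemma dot_sumr (I : Type) (r : seq I) (P : pred I) (u : I -> H) f :
  dot f (\sum_(i <- r | P i) u i) = \sum_(i <- r | P i) dot f (u i).
Proof. exact: linear_sumr. Qed.

Lemma dot_extr f g : (forall h, dot h f = dot h g) -> f = g.
Proof.
move=> fg; apply/eqP; rewrite -subr_eq0 -normr_eq0 -sqrf_eq0 -dot_norm dotBr.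
by rewrite fg subrr.
Qed.

Lemma cauchy_schwarz f g : `|dot f g| <= `|f| * `|g|.
Proof.
have [->|g0] := eqVneq g 0; first by rewrite dot0r !normr0 mulr0.
set p := `|g| ^+ 2; set d := dot f g.
have p0 : 0 < p by rewrite exprn_gt0// normr_gt0.
have pc : p^* = p by rewrite geC0_conj// ltW.
(* The residual of the projection of [f] on [g], scaled by [|g|^2] to avoid division; its squared
   norm is [p (p |f|^2 - |d|^2)]. *)
have : 0 <= dot (p *: f - d *: g) (p *: f - d *: g) by rewrite dot_norm exprn_ge0.
rewrite dotBl !dotBr !dotZl !dotZr !dot_norm (dotC g f) -/d -/p pc.
rewrite (mulrC p d^*) subrr subr0 -mulrBr -normCKC.
rewrite pmulr_rge0// subr_ge0 -exprMn => dfg.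
by rewrite -(@ler_pXn2r _ 2) ?nnegrE ?mulr_ge0// (mulrC `|f|).
Qed.

Lemma cvg_dotl (T : Type) (F : set_system T) {FF : Filter F} (u : T -> H) f g :
  u t @[t --> F] --> f -> dot (u t) g @[t --> F] --> dot f g.
Proof.
apply: (@lipschitz_cvg R H (CC R) T F FF (dot^~ g) `|g|) => // x y.
by rewrite -dotBl mulrC cauchy_schwarz.
Qed.

Lemma cvg_dotr (T : Type) (F : set_system T) {FF : Filter F} (u : T -> H) f g :
  u t @[t --> F] --> f -> dot g (u t) @[t --> F] --> dot g f.
Proof.
apply: (@lipschitz_cvg R H (CC R) T F FF (dot g) `|g|) => // x y.
by rewrite -dotBr cauchy_schwarz.
Qed.

(** On the trivial space the constant in [bounded_op] may be negative; its absolute value always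
    serves. *)
Lemma bounded_opP T : bounded_op T ->
  linear T /\ exists2 B, 0 <= B & forall f, `|T f| <= B * `|f|.
Proof.
move=> [lT [B hB]]; split=> //; exists (RtoC `|B|); first by rewrite RtoC_ge0.
by move=> f; apply: (le_trans (hB f)); rewrite ler_wpM2r// ler_RtoC ler_norm.
Qed.

Lemma bounded_opI T B : linear T -> (forall f, `|T f| <= B * `|f|) -> bounded_op T.
Proof.
move=> lT hB; split=> //; exists (Creal `|B|) => f; rewrite CrealK//.
have [->|f0] := eqVneq f 0; first by move: (hB 0); rewrite normr0 !mulr0.
have B0 : 0 <= B.
  by rewrite -(pmulr_lge0 _ (_ : 0 < `|f|)) ?normr_gt0// (le_trans _ (hB f)).
by rewrite ger0_norm.
Qed.

Section Linear.
Variables (T : H -> H) (lT : linear T).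

Lemma linD f g : T (f + g) = T f + T g.
Proof. by rewrite -[f in LHS]scale1r lT scale1r. Qed.

Lemma lin0 : T 0 = 0.
Proof. by apply: (addIr (T 0)); rewrite -linD !add0r. Qed.

Lemma linZ a f : T (a *: f) = a *: T f.
Proof. by rewrite -[a *: f]addr0 lT lin0 addr0. Qed.

Lemma linB f g : T (f - g) = T f - T g.
Proof. by rewrite -scaleN1r linD linZ scaleN1r. Qed.

Lemma lin_sum (I : Type) (r : seq I) (P : pred I) (u : I -> H) :
  T (\sum_(i <- r | P i) u i) = \sum_(i <- r | P i) T (u i).
Proof. by rewrite (big_morph T linD lin0). Qed.

End Linear.

Lemma cvg_bounded_op T (I : Type) (F : set_system I) {FF : Filter F} (u : I -> H) f :
  bounded_op T -> u t @[t --> F] --> f -> T (u t) @[t --> F] --> T f.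
Proof.
move=> /bounded_opP[lT [B B0 hB]]; apply: (@lipschitz_cvg R H H I F FF T B) => // x y.
by rewrite -linB.
Qed.

Lemma bounded_op_comp S T : bounded_op S -> bounded_op T -> bounded_op (S \o T).
Proof.
move=> /bounded_opP[lS [B B0 hB]] /bounded_opP[lT [C C0 hC]].
apply: (@bounded_opI _ (B * C)) => [a f g /=|f /=]; first by rewrite lT lS.
by apply: (le_trans (hB _)); rewrite -mulrA ler_wpM2l.
Qed.

Lemma bounded_opD S T : bounded_op S -> bounded_op T -> bounded_op (S \+ T).
Proof.
move=> /bounded_opP[lS [B B0 hB]] /bounded_opP[lT [C C0 hC]].
apply: (@bounded_opI _ (B + C)) => [a f g /=|f /=].
  by rewrite lT lS scalerDr addrACA.
by apply: (le_trans (ler_normD _ _)); rewrite mulrDl lerD.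
Qed.

Lemma bounded_opB S T : bounded_op S -> bounded_op T -> bounded_op (S \- T).
Proof.
move=> /bounded_opP[lS [B B0 hB]] /bounded_opP[lT [C C0 hC]].
apply: (@bounded_opI _ (B + C)) => [a f g /=|f /=].
  by rewrite lT lS scalerBr opprD addrACA.
by apply: (le_trans (ler_normB _ _)); rewrite mulrDl lerD.
Qed.

(** * Bessel, Parseval and existence of adjoints from an orthonormal basis *)

Section Orthonormal.
Variable e : nat -> H.
Hypothesis e_on : forall i j, dot (e i) (e j) = (i == j)%:R.

Lemma dot_on_sum (c : nat -> CC R) m n k :
  dot (\sum_(m <= i < n) c i *: e i) (e k) = if (m <= k < n)%N then c k else 0.
Proof.
rewrite dot_suml; under eq_bigr do rewrite dotZl e_on mulr_natr mulrb.
by rewrite -big_mkcond big_nat1_eq.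
Qed.

Lemma norm_on_sum (c : nat -> CC R) m n :
  `|\sum_(m <= i < n) c i *: e i| ^+ 2 = \sum_(m <= i < n) `|c i| ^+ 2.
Proof.
rewrite -dot_norm dot_sumr [LHS]big_nat [RHS]big_nat; apply: eq_bigr => i mn.
by rewrite dotZr dot_on_sum mn -normCKC.
Qed.

Lemma bessel f n : \sum_(0 <= k < n) `|dot f (e k)| ^+ 2 <= `|f| ^+ 2.
Proof.
set c := fun k => dot f (e k); set s := \sum_(0 <= k < n) c k *: e k.
have sf : dot f s = `|s| ^+ 2.
  rewrite norm_on_sum dot_sumr; apply: eq_bigr => k _.
  by rewrite dotZr -/(c k) -normCKC.
have fs : dot s f = `|s| ^+ 2 by rewrite dotC sf geC0_conj// exprn_ge0.
have : 0 <= dot (f - s) (f - s) by rewrite dot_norm exprn_ge0.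
by rewrite dotBl !dotBr sf fs !dot_norm subrr subr0 subr_ge0 norm_on_sum.
Qed.

(** Riesz-Fischer: by Pythagoras the blocks of the vector series have as squared norms the blocks of
    a bounded monotone real series, which is Cauchy. *)
Lemma cvg_on_series (c : nat -> CC R) (B : CC R) :
  (forall n, \sum_(0 <= k < n) `|c k| ^+ 2 <= B) ->
  cvgn (series (fun k => c k *: e k)).
Proof.
move=> hB; apply/cauchy_cvgP/cauchy_seriesP => eps eps0.
pose r k := Creal (`|c k| ^+ 2).
have rE k : RtoC (r k) = `|c k| ^+ 2 by rewrite CrealK// exprn_ge0.
have r0 k : 0 <= r k by rewrite -RtoC_ge0 rE exprn_ge0.
have B0 : 0 <= B by have := hB 0%N; rewrite big_geq.
have rcvg : cvgn (series r).
  apply: nondecreasing_is_cvgn; first exact: nondecreasing_series.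
  exists (Creal B) => _ [n _ <-].
  rewrite -ler_RtoC CrealK// rmorph_sum /=; under eq_bigr do rewrite rE.
  exact: hB.
move/cvg_cauchy/cauchy_seriesP : rcvg => /(_ (Creal eps ^+ 2)).
rewrite exprn_gt0 ?Creal_gt0// => /(_ isT); apply: filterS => -[m n] /=.
rewrite ger0_norm ?sumr_ge0// -ltr_RtoC rmorph_sum /=.
under eq_bigr do rewrite rE; rewrite -norm_on_sum rmorphXn /= CrealK ?(ltW eps0)//.
by rewrite ltr_pXn2r ?nnegrE// ltW.
Qed.

Hypothesis e_complete : forall f, (forall n, dot f (e n) = 0) -> f = 0.

Lemma onb_ext f g : (forall n, dot f (e n) = dot g (e n)) -> f = g.
Proof.
move=> fg; apply/eqP; rewrite -subr_eq0; apply/eqP/e_complete => n.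
by rewrite dotBl fg subrr.
Qed.

(** Bessel gives some limit of the series; it has the same coefficients as [f], so completeness
    identifies the two. *)
Lemma onb_expansion f : series (fun k => dot f (e k) *: e k) @ \oo --> f.
Proof.
have /cvg_ex[s sP] := cvg_on_series (bessel f).
suff fs : f = s by rewrite [X in _ --> X]fs.
apply: onb_ext => n; apply/esym.
apply: cvgC_unique (cvg_dotl (g := e n) sP) _.
apply: cvg_near_cst; exists n.+1 => // m /= nm.
by rewrite /series /= dot_on_sum leq0n nm.
Qed.

Lemma onb_dot T f g : bounded_op T ->
  series (fun k => dot f (e k) * dot (T (e k)) g) @ \oo --> dot (T f) g.
Proof.
move=> bT; have [lT _] := bT.
have -> : series (fun k => dot f (e k) * dot (T (e k)) g) =
    (fun n => dot (T (series (fun k => dot f (e k) *: e k) n)) g).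
  apply/funext => n; rewrite /series /= lin_sum// dot_suml.
  by apply: eq_bigr => k _; rewrite linZ ?dotZl.
exact: cvg_dotl (cvg_bounded_op bT (@onb_expansion f)).
Qed.

Lemma bounded_id : bounded_op (id : H -> H).
Proof. by apply: (@bounded_opI _ 1) => // f; rewrite mul1r. Qed.

Lemma parseval f : series (fun k => `|dot f (e k)| ^+ 2) @ \oo --> `|f| ^+ 2.
Proof.
have -> : (fun k => `|dot f (e k)| ^+ 2) = (fun k => dot f (e k) * dot (e k) f).
  by apply/funext => k; rewrite normCK (dotC (e k)).
by rewrite -dot_norm; exact: (@onb_dot id f f bounded_id).
Qed.

(** Since [adjoint] is defined by choice, a witness is required: [g] is sent to the sum of the
    [<g, T e_k> e_k]. *)
Lemma adjointP T : bounded_op T -> is_adjoint dot T (adjoint dot T).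
Proof.
move=> bT; suff : exists S, is_adjoint dot T S by apply: xgetPex.
have [lT [B B0 hB]] := bounded_opP bT.
(* For the partial sum [h] one has [|h|^2 = <T h, g> <= B |h| |g|], hence [|h| <= B |g|], which
   makes the defining series converge. *)
have bd g n : \sum_(0 <= k < n) `|dot g (T (e k))| ^+ 2 <= (B * `|g|) ^+ 2.
  pose h := \sum_(0 <= k < n) dot g (T (e k)) *: e k.
  rewrite -norm_on_sum -/h ler_pXn2r ?nnegrE ?mulr_ge0//.
  have [->|h0] := eqVneq h 0; first by rewrite normr0 mulr_ge0.
  rewrite -(@ler_pM2l _ `|h|) ?normr_gt0// -expr2.
  have -> : `|h| ^+ 2 = dot (T h) g.
    rewrite norm_on_sum lin_sum// dot_suml; apply: eq_bigr => k _.
    by rewrite linZ// dotZl (dotC (T _)) -normCK.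
  have th : 0 <= dot (T h) g.
    rewrite lin_sum// dot_suml; apply: sumr_ge0 => k _.
    by rewrite linZ// dotZl (dotC (T _)) -normCK exprn_ge0.
  rewrite -(ger0_norm th) (le_trans (cauchy_schwarz _ _))// mulrA ler_wpM2r//.
  by rewrite mulrC hB.
exists (fun g => limn (series (fun k => dot g (T (e k)) *: e k))) => f g.
have h := cvg_dotr (g := f) (cvg_on_series (bd g)).
have := @onb_dot T f g bT.
have -> : series (fun k => dot f (e k) * dot (T (e k)) g) =
    (fun n => dot f (series (fun k => dot g (T (e k)) *: e k) n)).
  apply/funext => n; rewrite /series /= dot_sumr; apply: eq_bigr => k _.
  by rewrite dotZr -dotC mulrC.
by move=> l1; exact: cvgC_unique l1 (h _).
Qed.

(** The bound comes from [|T^* f|^2 = <T T^* f, f> <= B |T^* f| |f|]. *)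
Lemma bounded_adjoint T : bounded_op T -> bounded_op (adjoint dot T).
Proof.
move=> bT; have aT := adjointP bT; have [lT [B B0 hB]] := bounded_opP bT.
apply: (@bounded_opI _ B) => [a f g|f].
  by apply: dot_extr => h; rewrite dotDr dotZr -!aT dotDr dotZr.
set s := adjoint dot T f.
have [->|s0] := eqVneq s 0; first by rewrite normr0 mulr_ge0.
rewrite -(@ler_pM2l _ `|s|) ?normr_gt0// -expr2 -dot_norm -aT.
have th : 0 <= dot (T s) f by rewrite aT dot_norm exprn_ge0.
rewrite -(ger0_norm th) (le_trans (cauchy_schwarz _ _))// mulrA ler_wpM2r//.
by rewrite mulrC hB.
Qed.

End Orthonormal.
End Hilbert.

(** * Series of nonnegative reals *)

Section RealSeries.
Context {R : realType}.

Lemma cvg_finsum (K : numFieldType) (V : normedModType K) (I T : Type) (F : set_system T) {FF : Filter F}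
    (r : seq I) (f : I -> T -> V) (l : I -> V) :
  (forall i, f i t @[t --> F] --> l i) ->
  \sum_(i <- r) f i t @[t --> F] --> \sum_(i <- r) l i.
Proof. by move=> fl; apply: cvg_big => //; exact: add_continuous. Qed.

Lemma series_le_lim (u : nat -> R) (s : R) n :
  (forall k, 0 <= u k) -> series u @ \oo --> s -> series u n <= s.
Proof.
move=> u0 us; rewrite -(cvg_lim (@Rhausdorff R) us).
apply: nondecreasing_cvgn_le; first exact: nondecreasing_series.
by apply/cvg_ex; exists s.
Qed.

Lemma ler_sum_sub (I : eqType) (s1 s2 : seq I) (f : I -> R) :
  (forall i, 0 <= f i) -> uniq s1 -> uniq s2 -> {subset s1 <= s2} ->
  \sum_(i <- s1) f i <= \sum_(i <- s2) f i.
Proof.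
move=> f0 u1 u2 s12; have ps : perm_eq s1 [seq i <- s2 | i \in s1].
  apply: uniq_perm => //; first exact: filter_uniq.
  by move=> i; rewrite mem_filter; case: (boolP (i \in s1)) => // /s12.
by rewrite (perm_big _ ps) /= big_filter big_mkcond; apply: ler_sum => i _; case: ifP.
Qed.

(** A tool for comparing two summation orders of nonnegative terms: each partial sum in one order is
    below some later partial sum in the other. *)
Lemma cvg_of_squeeze (u v : nat -> R) (s : R) :
  nondecreasing_seq u -> v @ \oo --> s -> (forall n, u n <= s) ->
  (forall k, exists n, v k <= u n) -> u @ \oo --> s.
Proof.
move=> u_nd vs us vu; apply/cvgrPdist_lt => e e0.
have /cvgrPdist_lt/(_ e e0)[k _ vk] := vs.
have [n vn] := vu k; exists n => // m /= nm.
have := vk k (leqnn k); rewrite /= !ger0_norm ?subr_ge0 ?us//; last first.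
  by rewrite (le_trans vn).
by apply: le_lt_trans; rewrite lerD2l lerN2 (le_trans vn)// u_nd.
Qed.

(** Every initial segment of the enumeration lies in a square and every square in an initial
    segment; with nonnegative terms the two limits agree. *)
Lemma cvg_double_series (g : nat -> nat -> R) (b : nat -> nat * nat) (s : R) :
  (forall k l, 0 <= g k l) -> bijective b ->
  \sum_(0 <= k < n) \sum_(0 <= l < n) g k l @[n --> \oo] --> s ->
  series (fun n => g (b n).1 (b n).2) @ \oo --> s.
Proof.
move=> g0 [b' bK b'K] gs.
pose G n := \sum_(0 <= k < n) \sum_(0 <= l < n) g k l.
have GE n : G n = \sum_(kl <- allpairs pair (index_iota 0 n) (index_iota 0 n)) g kl.1 kl.2.
  by rewrite big_allpairs.
have G_uniq n : uniq (allpairs pair (index_iota 0 n) (index_iota 0 n)).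
  by rewrite allpairs_uniq ?iota_uniq// => -[? ?] [].
have sE n : series (fun n => g (b n).1 (b n).2) n =
    \sum_(kl <- map b (index_iota 0 n)) g kl.1 kl.2 by rewrite big_map.
have s_uniq n : uniq (map b (index_iota 0 n)).
  by rewrite map_inj_uniq ?iota_uniq//; exact: can_inj bK.
have G_nd : nondecreasing_seq G.
  move=> m n mn; rewrite !GE; apply: ler_sum_sub => //.
  move=> _ /allpairsP[[k l] /= [km lm ->]]; apply/allpairsP; exists (k, l).
  by move: km lm; rewrite !mem_index_iota /= => km lm; split=> //; exact: leq_trans mn.
apply: (@cvg_of_squeeze _ G) => //.
- exact: nondecreasing_series.
- move=> n; pose K := (\max_(i < n) maxn (b i).1 (b i).2).+1.
  rewrite -(cvg_lim (@Rhausdorff R) gs).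
  apply: (@le_trans _ _ (G K)); last first.
    by apply: nondecreasing_cvgn_le => //; apply/cvg_ex; exists s.
  rewrite sE GE; apply: ler_sum_sub => // _ /mapP[i i_n ->].
  rewrite mem_index_iota /= in i_n.
  have [lt1 lt2] : ((b i).1 < K)%N /\ ((b i).2 < K)%N.
    apply/andP; rewrite !ltnS -geq_max.
    exact: (leq_bigmax (F := fun i : 'I_n => maxn (b i).1 (b i).2) (Ordinal i_n)).
  by apply/allpairsP; exists (b i); rewrite !mem_index_iota; split=> //; case: (b i).
- move=> K; pose n := (\max_(kl : 'I_K * 'I_K) b' (nat_of_ord kl.1, nat_of_ord kl.2)).+1.
  exists n; rewrite -/(G K) sE GE; apply: ler_sum_sub => //.
  move=> _ /allpairsP[[k l] [km lm ->]]; rewrite !mem_index_iota /= in km lm.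
  apply/mapP; exists (b' (k, l)); last by rewrite b'K.
  rewrite mem_index_iota ltnS.
  exact: (leq_bigmax (F := fun kl : 'I_K * 'I_K => b' (nat_of_ord kl.1, nat_of_ord kl.2)) (Ordinal km, Ordinal lm)).
Qed.

(* With c n i = |<e'_n, e_i>|^2 for orthonormal bases e and e', this says that the
   trace of the diagonal operator with eigenvalues d may be computed in e'. *)
Lemma cvg_series_weighted (d : nat -> R) (c : nat -> nat -> R) (t : nat -> R) (s : R) :
  (forall i, 0 <= d i) -> (forall n i, 0 <= c n i) ->
  (forall i, series (c^~ i) @ \oo --> (1 : R)) ->
  (forall n, series (fun i => d i * c n i) @ \oo --> t n) ->
  series d @ \oo --> s -> series t @ \oo --> s.
Proof.
move=> d0 c0 c1 dct ds.
have dc0 n i : 0 <= d i * c n i by rewrite mulr_ge0.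
have t0 n : 0 <= t n.
  by apply: le_trans (series_le_lim 0 (dc0 n) (dct n)); rewrite /series /= big_geq.
(* Upper bound: after exchanging the two finite sums, each column sum of [c] is at most 1. *)
have ts n : series t n <= s.
  have h : \sum_(0 <= m < n) series (fun i => d i * c m i) k @[k --> \oo] --> series t n.
    exact: (@cvg_finsum _ R^o).
  apply: (cvgr_to_le h); near=> k.
  apply: le_trans (series_le_lim k d0 ds); rewrite /series /= exchange_big /=.
  apply: ler_sum => i _; rewrite -mulr_sumr ler_piMr//.
  exact: (series_le_lim n (fun n => c0 n i) (c1 i)).
have tcvg : cvgn (series t).
  apply: nondecreasing_is_cvgn; first exact: nondecreasing_series.
  by exists s => _ [n _ <-].
suff st : s <= limn (series t).
  have -> : s = limn (series t); last exact: tcvg.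
  by apply/le_anti; rewrite st /= limr_le//; near=> n.
(* Lower bound: in a finite sum of [d] each factor 1 is written as a limit of column sums of [c],
   and the resulting truncated double sums are below the partial sums of [t]. *)
apply: (cvgr_to_le ds); near=> I.
have h : \sum_(0 <= i < I) d i * series (c^~ i) n @[n --> \oo] --> \sum_(0 <= i < I) d i * 1.
  apply: (@cvg_finsum _ R^o) => i; apply: cvgMr; exact: c1.
rewrite /series /=; under eq_bigr do rewrite -[d _]mulr1.
apply: (cvgr_to_le h); near=> n.
apply: (@le_trans _ _ (series t n)); last first.
  by apply: nondecreasing_cvgn_le => //; exact: nondecreasing_series.
rewrite /series /=; under eq_bigr do rewrite mulr_sumr; rewrite exchange_big /=.
by apply: ler_sum => m _; exact: (series_le_lim I (dc0 m) (dct m)).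
Unshelve. all: by end_near. Qed.

End RealSeries.

(** * Diagonal operators *)

Section Diagonal.
Context {R : realType} {H : completeNormedModType (CC R)}.
Variable dot : {dot H for Num.conj}.
Hypothesis dot_norm : inner_product_norm dot.

Lemma cvg_RtoC_real (u : nat -> R) (l : CC R) :
  RtoC (u n) @[n --> \oo] --> l -> RtoC (Creal l) = l /\ (u @ \oo --> Creal l).
Proof.
move=> ul; have /is_cvg_RtoC/cvg_ex[x ux] : cvgn (fun n => RtoC (u n)).
  by apply/cvg_ex; exists l.
have -> : l = RtoC x by apply: cvgC_unique ul _; exact/cvg_RtoC.
by rewrite Creal_RtoC.
Qed.

(** Taken in the reals so that monotone convergence and the order of the real line apply. *)
Definition weight (f g : H) : R := Creal (`|dot f g| ^+ 2).

Lemma weight_ge0 f g : 0 <= weight f g.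
Proof. by rewrite Creal_ge0// exprn_ge0. Qed.

Lemma weightC f g : weight f g = weight g f.
Proof. by rewrite /weight (dotC dot f) norm_conjC. Qed.

Lemma RtoC_weight f g : RtoC (weight f g) = `|dot f g| ^+ 2.
Proof. by rewrite CrealK// exprn_ge0. Qed.

Lemma weight_series (e : nat -> H) f : orthonormal_basis dot e ->
  series (fun k => weight f (e k)) @ \oo --> Creal (`|f| ^+ 2).
Proof.
move=> [e_on e_c]; have := @parseval _ _ _ dot_norm _ e_on e_c f.
have -> : series (fun k => `|dot f (e k)| ^+ 2) =
    (fun n => RtoC (series (fun k => weight f (e k)) n)).
  apply/funext => n; rewrite /series /= rmorph_sum /=.
  by apply: eq_bigr => k _; rewrite RtoC_weight.
by case/cvg_RtoC_real.
Qed.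

Variables (e : nat -> H) (D : H -> H) (d : nat -> R).
Hypotheses (e_onb : orthonormal_basis dot e) (bD : bounded_op D).
Hypothesis De : forall n, D (e n) = RtoC (d n) *: e n.

Lemma diag_dot f : RtoC (Creal (dot (D f) f)) = dot (D f) f /\
  (series (fun k => d k * weight f (e k)) @ \oo --> Creal (dot (D f) f)).
Proof.
have [e_on e_c] := e_onb; apply: cvg_RtoC_real.
have := @onb_dot _ _ _ dot_norm _ e_on e_c D f f bD.
suff -> : series (fun k => dot f (e k) * dot (D (e k)) f) =
  (fun n => RtoC (series (fun k => d k * weight f (e k)) n)) by [].
apply/funext => n; rewrite /series /= rmorph_sum /=; apply: eq_bigr => k _.
by rewrite De dotZl rmorphM /= RtoC_weight normCK -dotC mulrCA.
Qed.

Lemma diag_positive : positive_op dot D <-> forall n, 0 <= d n.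
Proof.
have [e_on _] := e_onb; split=> [pD n|d0 f].
  by have := pD (e n); rewrite De dotZl e_on eqxx mulr1 RtoC_ge0.
have [<- fd] := diag_dot f; rewrite RtoC_ge0.
apply: (cvgr_to_ge fd); near=> n; apply: sumr_ge0 => k _.
by rewrite mulr_ge0// weight_ge0.
Unshelve. all: by end_near. Qed.

Lemma diag_self_adjoint : adjoint dot D = D.
Proof.
have [e_on e_c] := e_onb; have aD := @adjointP _ _ _ dot_norm _ e_on e_c _ bD.
have aDe n : adjoint dot D (e n) = D (e n).
  apply: (onb_ext e_c) => m; rewrite De dotZl dotC -aD De dotZl !e_on rmorphM /=.
  rewrite conjC_RtoC conjC_nat [in RHS]eq_sym.
  by have [->|] := eqVneq m n; rewrite ?mulr0.
apply/funext => f; apply: (onb_ext e_c) => n.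
rewrite aD aDe dotC -aD.
by rewrite De dotZl dotZr rmorphM /= conjC_RtoC -dotC.
Qed.

(** A nonnegative diagonal operator is positive and self-adjoint, hence its own absolute value. In
    another basis its diagonal entries are averages of the [d i] with weights [|<e'_n, e_i>|^2],
    whose sum over [n] is [|e_i|^2 = 1]. *)
Lemma diag_trace s : (forall n, 0 <= d n) -> series d @ \oo --> s ->
  is_trace dot D (RtoC s).
Proof.
move=> d0 ds; have [e_on e_c] := e_onb; split; last first.
  move=> e' [e'_on e'_c].
  have dE n : dot (D (e' n)) (e' n) = RtoC (Creal (dot (D (e' n)) (e' n))).
    by have [-> _] := diag_dot (e' n).
  have -> : (fun n => dot (D (e' n)) (e' n)) =
     (fun n => RtoC (Creal (dot (D (e' n)) (e' n)))) by apply/funext.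
  apply/cvg_seriesRtoC.
  apply: (@cvg_series_weighted _ d (fun n i => weight (e' n) (e i))) => //.
  - by move=> n i; exact: weight_ge0.
  - move=> i; under eq_fun do rewrite weightC.
    have := @weight_series e' (e i) (conj e'_on e'_c).
    by rewrite -dot_norm e_on eqxx.
  - by move=> n; have [_] := diag_dot (e' n).
split=> //; exists D; first by split=> //; [exact/diag_positive|rewrite diag_self_adjoint].
exists e => //; have -> : (fun n => dot (D (e n)) (e n)) = (fun n => RtoC (d n)).
  by apply/funext => n; rewrite De dotZl e_on eqxx mulr1.
by apply/cvg_ex; exists (RtoC s); exact/cvg_seriesRtoC.
Qed.

End Diagonal.

(** * Power series of (1 - p)^-m *)

Section ReciprocalPower.
Context {R : realType}.
Implicit Types (p q : {poly R}) (m n k : nat) (t : R).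

Definition nneg p := forall k, 0 <= p`_k.

Lemma nneg0 : nneg 0.
Proof. by move=> k; rewrite coef0. Qed.

Lemma nneg1 : nneg 1.
Proof. by move=> k; rewrite coef1 ler0n. Qed.

Lemma nnegXn n : nneg 'X^n.
Proof. by move=> k; rewrite coefXn ler0n. Qed.

Lemma nnegD p q : nneg p -> nneg q -> nneg (p + q).
Proof. by move=> p0 q0 k; rewrite coefD addr_ge0. Qed.

Lemma nnegM p q : nneg p -> nneg q -> nneg (p * q).
Proof. by move=> p0 q0 k; rewrite coefM sumr_ge0// => i _; rewrite mulr_ge0. Qed.

Lemma nneg_exp p n : nneg p -> nneg (p ^+ n).
Proof.
by move=> p0; elim: n => [|n IH]; [exact: nneg1 | rewrite exprS; exact: nnegM].
Qed.

Lemma nneg_horner p t : nneg p -> 0 <= t -> 0 <= p.[t].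
Proof.
move=> p0 t0; rewrite horner_coef; apply: sumr_ge0 => i _.
by rewrite mulr_ge0 ?exprn_ge0 ?p0.
Qed.

Lemma nneg_horner_le p t n : nneg p -> 0 <= t ->
  \sum_(0 <= k < n) p`_k * t ^+ k <= p.[t].
Proof.
move=> p0 t0; rewrite (@horner_coef_wide _ (maxn n (size p))) ?leq_maxr//.
rewrite -(big_mkord xpredT (fun k => p`_k * t ^+ k)).
rewrite (big_cat_nat (n := n) (p := maxn n (size p))) ?leq_maxl//= lerDl.
by apply: sumr_ge0 => i _; rewrite mulr_ge0 ?exprn_ge0 ?p0.
Qed.

Definition geom_poly p n : {poly R} := \sum_(i < n) p ^+ i.

(* Since p has no constant term, adding p^(k+1) and higher powers to the geometric
   sum does not change the k-th coefficient. *)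
Definition recip_coef p m k : R := (geom_poly p k.+1 ^+ m)`_k.

Lemma nneg_geom p n : nneg p -> nneg (geom_poly p n).
Proof.
by move=> p0 k; rewrite coef_sum sumr_ge0// => i _; exact: nneg_exp.
Qed.

(** A congruence modulo [X^n] that also records the sign of the remainder: coefficients below [n]
    are unchanged and the others can only grow. *)
Lemma expD_mulXn p q m n : nneg p -> nneg q ->
  exists2 r, nneg r & (p + q * 'X^n) ^+ m = p ^+ m + r * 'X^n.
Proof.
move=> p0 q0; elim: m => [|m [r r0 IH]]; first by exists 0; [exact: nneg0 | rewrite mul0r addr0 !expr0].
exists ((p + q * 'X^n) * r + q * p ^+ m).
  apply: nnegD; apply: nnegM => //; last exact: nneg_exp.
  by apply: nnegD => //; apply: nnegM => //; exact: nnegXn.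
by rewrite !exprS IH; ring.
Qed.

Section NoConstantTerm.
Variables (p : {poly R}) (m : nat).
Hypotheses (p0 : nneg p) (p_0 : p`_0 = 0) (p_1 : 0 < p`_1).

Lemma pX : exists2 q, nneg q & p = q * 'X.
Proof.
have /factor_theorem[q pq] : root p 0 by rewrite /root horner_coef0 p_0.
rewrite subr0 in pq; exists q => //; move=> i.
by have := p0 i.+1; rewrite pq coefMX.
Qed.

(** The new summand [p ^+ n] is divisible by [X^n], as [p] has no constant term. *)
Lemma geom_poly_expS n : exists2 r, nneg r &
  geom_poly p n.+1 ^+ m = geom_poly p n ^+ m + r * 'X^n.
Proof.
have [q q0 pq] := pX.
rewrite /geom_poly big_ord_recr /= [in p ^+ n]pq exprMn.
by apply: expD_mulXn; [exact: nneg_geom | exact: nneg_exp].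
Qed.

Lemma geom_coef_eq n k : (k < n)%N -> (geom_poly p n ^+ m)`_k = recip_coef p m k.
Proof.
elim: n => // n IH; rewrite ltnS leq_eqVlt => /predU1P[->//|kn].
have [r r0 ->] := geom_poly_expS n.
by rewrite coefD coefMXn kn addr0 IH.
Qed.

Lemma geom_coef_le n k : (geom_poly p n ^+ m)`_k <= recip_coef p m k.
Proof.
have h i j : (geom_poly p i ^+ m)`_k <= (geom_poly p (i + j) ^+ m)`_k.
  elim: j => [|j IH]; first by rewrite addn0.
  have [r r0 rE] := geom_poly_expS (i + j); rewrite addnS rE coefD.
  apply: (le_trans IH); rewrite lerDl coefMXn; case: ifP => // _.
by rewrite -(@geom_coef_eq (n + k.+1)) ?h// addnS ltnS leq_addl.
Qed.

(** One factor contributes [p ^+ k], whose coefficient at [X^k] is the [k]-th power of the linear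
    coefficient of [p]; the remaining factors contribute their positive constant terms, and nothing
    is negative. *)
Lemma recip_coef_gt0 k : (0 < m)%N -> 0 < recip_coef p m k.
Proof.
case: m => // m' _; rewrite /recip_coef exprSr.
have gk : 0 < (geom_poly p k.+1)`_k.
  rewrite /geom_poly big_ord_recr /= coefD ltr_wpDl ?nneg_geom//.
  have [q q0 pq] := pX; rewrite pq exprMn coefMXn ltnn subnn.
  have -> : (q ^+ k)`_0 = q`_0 ^+ k by rewrite -!horner_coef0 horner_exp.
  by move: p_1; rewrite pq coefMX /= => q1; rewrite exprn_gt0.
have g0 : 0 < (geom_poly p k.+1 ^+ m')`_0.
  rewrite -horner_coef0 horner_exp exprn_gt0// /geom_poly big_ord_recl expr0.
  rewrite hornerD hornerC ltr_wpDr// horner_sum sumr_ge0// => i _.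
  by apply: nneg_horner => //; exact: nneg_exp.
rewrite coefM big_ord_recl /= subn0 ltr_pwDl ?mulr_gt0//.
by apply: sumr_ge0 => i _; rewrite mulr_ge0 //; [apply: nneg_exp; exact: nneg_geom | exact: nneg_geom].
Qed.

(** The values of [geom_poly p n ^+ m] are powers of partial geometric sums and tend to the right
    side. Their first [n] coefficients are exact and all of them are at most the final ones, so the
    partial sums are squeezed wherever [p.[t] < 1]. *)
Lemma recip_coef_series t : 0 <= t -> p.[t] < 1 ->
  series (fun k => recip_coef p m k * t ^+ k) @ \oo --> (1 - p.[t]) ^- m.
Proof.
move=> t0 pt; have pt0 : 0 <= p.[t] by exact: nneg_horner.
have r0 k : 0 <= recip_coef p m k * t ^+ k.
  by rewrite mulr_ge0 ?exprn_ge0//; apply: nneg_exp; exact: nneg_geom.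
have gt n : (geom_poly p n ^+ m).[t] = series (geometric 1 p.[t]) n ^+ m.
  rewrite horner_exp horner_sum /series /= big_mkord; congr (_ ^+ m).
  by apply: eq_bigr => i _; rewrite horner_exp mul1r.
have gcvg : (geom_poly p n ^+ m).[t] @[n --> \oo] --> (1 - p.[t]) ^- m.
  under eq_fun do rewrite gt.
  rewrite -exprVn -div1r; apply: (continuous_cvg _ (@exprn_continuous R m _)).
  by apply: cvg_geometric_series; rewrite ger0_norm.
apply: (cvg_of_squeeze _ gcvg).
- exact: nondecreasing_series.
- move=> n; apply: (@le_trans _ _ (geom_poly p n ^+ m).[t]).
    apply: le_trans (nneg_horner_le n (nneg_exp m (nneg_geom n p0)) t0).
    rewrite /series /= !big_nat; apply: ler_sum => k /andP[_ kn].
    by rewrite geom_coef_eq.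
  rewrite -(cvg_lim (@Rhausdorff R) gcvg).
  apply: nondecreasing_cvgn_le; last by apply/cvg_ex; exists ((1 - p.[t]) ^- m).
  apply/nondecreasing_seqP => k; have [r r0' ->] := geom_poly_expS k.
  by rewrite hornerD lerDl nneg_horner//; apply: nnegM => //; exact: nnegXn.
- move=> n; exists (size (geom_poly p n ^+ m)).
  rewrite horner_coef /series /= big_mkord; apply: ler_sum => i _.
  by rewrite ler_wpM2r ?exprn_ge0// geom_coef_le.
Qed.

End NoConstantTerm.

(** The lowest nonzero term dominates near 0: at [t = s * t0] every later term carries at least the
    factor [s ^ (k+1)], so a vanishing sum forces [|a k| t0^k <= s S] for all [s] in (0,1), where
    [S] is the absolute sum at [t0]. *)
Lemma power_series_eq0 (a : nat -> R) (t0 : R) : 0 < t0 ->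
  cvgn (series (fun k => `|a k| * t0 ^+ k)) ->
  (forall t, 0 < t < t0 -> series (fun k => a k * t ^+ k) @ \oo --> (0 : R)) ->
  forall k, a k = 0.
Proof.
move=> t00 acvg a0; elim/ltn_ind => k IH.
set S := limn (series (fun k => `|a k| * t0 ^+ k)).
have S_ge n : series (fun k => `|a k| * t0 ^+ k) n <= S.
  apply: nondecreasing_cvgn_le => //; apply: nondecreasing_series => i _ _.
  by rewrite mulr_ge0// exprn_ge0// ltW.
have key s : 0 < s < 1 -> `|a k| * t0 ^+ k <= s * S.
  move=> /andP[s0 s1]; set t := s * t0.
  have tt : 0 < t < t0 by rewrite mulr_gt0//= gtr_pMl.
  suff : `|a k| * t ^+ k <= s ^+ k * (s * S).
    by rewrite exprMn mulrCA ler_pM2l ?exprn_gt0.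
  have h := cvg_norm (a0 t tt); rewrite normr0 in h.
  have {}h : `|series (fun k => a k * t ^+ k) n| + s ^+ k * (s * S) @[n --> \oo] --> s ^+ k * (s * S).
    by rewrite -[X in _ --> X]add0r; exact: (cvgD (h _) (cvg_cst _)).
  apply: (cvgr_to_ge h); near=> n.
  have kn : (k < n)%N by near: n; exists k.+1.
  have -> : series (fun k => a k * t ^+ k) n =
      a k * t ^+ k + \sum_(k.+1 <= i < n) a i * t ^+ i.
    rewrite /series /= (big_cat_nat (n := k)) ?leq0n 1?ltnW//= big_nat big1 ?add0r.
      by rewrite big_ltn.
    by move=> i /andP[_ ik]; rewrite IH// mul0r.
  rewrite -[`|a k| * _]/(`|a k| * (t ^+ k)).
  have tk : `|t ^+ k| = t ^+ k by rewrite ger0_norm// exprn_ge0// ltW// (andP tt).1.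
  rewrite -{1}tk -normrM.
  set A := a k * t ^+ k; set B := \sum_(_ <= _ < _) _.
  have -> : `|A| = `|A + B - B| by rewrite addrK.
  apply: (le_trans (ler_normB _ _)); rewrite lerD2l.
  apply: (le_trans (ler_norm_sum _ _ _)).
  apply: (@le_trans _ _ (s ^+ k.+1 * \sum_(k.+1 <= i < n) `|a i| * t0 ^+ i)).
    rewrite mulr_sumr !big_nat; apply: ler_sum => i /andP[ki _].
    rewrite normrM normrX (ger0_norm (ltW (andP tt).1)) exprMn !mulrA.
    rewrite ler_wpM2r ?exprn_ge0 ?(ltW t00)// mulrC ler_wpM2r//.
    by rewrite ler_wiXn2l ?ltW.
  rewrite exprSr -mulrA !ler_wpM2l ?exprn_ge0 ?(ltW s0)//.
  apply: le_trans (S_ge n); rewrite /series /= [X in _ <= X](big_cat_nat (n := k.+1))// lerDr.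
  by apply: sumr_ge0 => i _; rewrite mulr_ge0// exprn_ge0// ltW.
apply/eqP; rewrite -normr_eq0; apply/negP => /negP ak0.
have al0 : 0 < `|a k| * t0 ^+ k by rewrite mulr_gt0 ?exprn_gt0// lt_def ak0 /=.
set al := `|a k| * t0 ^+ k in al0 key.
have alS : al <= S.
  apply: le_trans (S_ge k.+1); rewrite /series /= big_nat_recr//= lerDr.
  by apply: sumr_ge0 => i _; rewrite mulr_ge0// exprn_ge0// ltW.
have S0 : 0 < S by exact: lt_le_trans alS.
(* For this [s] the bound reads [al <= al / 2]; it is below 1 because [al <= S]. *)
have := key (al / S / 2); rewrite divr_gt0 ?divr_gt0//=.
rewrite ltr_pdivrMr// mul1r (@le_lt_trans _ _ 1) ?ltr1n ?ler_pdivrMr ?mul1r// => /(_ isT).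
rewrite mulrAC divfK ?gt_eqF// leNgt ltr_pdivrMr// ltr_pMr// ltr1n //.
Unshelve. all: by end_near. Qed.

End ReciprocalPower.

(** * Restriction of the two-variable data to one coordinate *)

Section OneVariable.
Context {R : realType}.
Variables (j : 'I_2) (p : mpoly.mpoly 2 R).

Definition upoly : {poly R} :=
  \sum_(al <- mpoly.msupp p) mpoly.mcoeff al p *: 'X^(al j).

Hypothesis p_j : forall al i, mpoly.mcoeff al p != 0 -> i != j -> al i = 0%N.

Lemma peval_upoly (z : 'rV[CC R]_2) :
  peval p z = (map_poly (@RtoC R) upoly).[z 0 j].
Proof.
rewrite /peval /mpoly.mmap /upoly rmorph_sum /= horner_sum big_seq [RHS]big_seq.
apply: eq_bigr => al; rewrite mpoly.mcoeff_msupp => pal.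
rewrite map_polyZ map_polyXn hornerZ hornerXn; congr (_ * _).
rewrite /mpoly.mmap1 (bigD1 j)//= big1 ?mulr1// => i ij.
by rewrite (p_j pal ij) expr0.
Qed.

(** [bmultinom 2 N] holds the multi-indices of degree below [N], and those supported on coordinate
    [j] are the [k eps_j] with [k < N]. Partial sums by total degree thus become ordinary partial
    sums of the same length. *)
Lemma sum_bmultinom (V : nmodType) (F : mindex -> V) N :
  (forall (al : mindex) i, i != j -> al i != 0%N -> F al = 0) ->
  \sum_(al : mpoly.bmultinom 2 N) F al =
  \sum_(0 <= k < N) F (mpoly.mnm_muln (mpoly.mnm1 j) k).
Proof.
move=> F0; rewrite big_mkord.
have dk (k : 'I_N) : (mpoly.mdeg (mpoly.mnm_muln (mpoly.mnm1 j) k) < N)%N.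
  by rewrite mpoly.mdegMn mpoly.mdeg1 mul1n.
have kd (al : mpoly.bmultinom 2 N) : (mpoly.bmnm al j < N)%N.
  case: al => al /=; apply: leq_ltn_trans.
  by rewrite mpoly.mdegE (bigD1 j)//= leq_addr.
pose h k := mpoly.BMultinom (dk k).
pose h' al := Ordinal (kd al).
rewrite (bigID (fun al : mpoly.bmultinom 2 N => all (fun i => (i == j) || (mpoly.bmnm al i == 0%N)) (enum 'I_2))) /=.
rewrite [X in _ + X]big1 ?addr0; last first.
  by move=> al /allPn[i _]; rewrite negb_or => /andP[ij ali]; exact: F0 ij ali.
rewrite (reindex_onto h h') /=; last first.
  move=> al /allP al0; apply/val_inj/mpoly.mnmP => i /=.
  rewrite mpoly.mulmnE mpoly.mnm1E.
  have [->|ij] := eqVneq j i; first by rewrite mul1n.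
  by rewrite mul0n; have := al0 i; rewrite mem_enum eq_sym (negbTE ij) => /(_ isT)/eqP.
apply: eq_bigl => k; apply/andP; split.
  apply/allP => i _; have [//|/= ij] := eqVneq i j.
  by rewrite mpoly.mulmnE mpoly.mnm1E [j == i]eq_sym (negbTE ij).
by apply/eqP/val_inj => /=; rewrite mpoly.mulmnE mpoly.mnm1E eqxx mul1n.
Qed.

Lemma univariate_expansion (n : nat) (A : mindex -> R) : is_expansion p n A ->
  let a k := A (mpoly.mnm_muln (mpoly.mnm1 j) k) in
  exists2 r : R, 0 < r & forall t : CC R, `|t| < RtoC r ->
    cvgn (series (fun k => `|RtoC (a k)| * `|t| ^+ k)) /\
    series (fun k => RtoC (a k) * t ^+ k) @ \oo -->
      (1 - (map_poly (@RtoC R) upoly).[t]) ^- n.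
Proof.
move=> [r r0 hr] a; exists r => // t tr.
(* Setting the other coordinate to 0 kills every monomial outside the [j]-th axis. *)
pose z : 'rV[CC R]_2 := \row_i (if i == j then t else 0).
have zr i : `|z 0 i| < RtoC r.
  by rewrite mxE; case: ifP => // _; rewrite normr0 RtoC_gt0.
have [h1 h2] := hr z zr.
have mz (al : mindex) i : i != j -> al i != 0%N -> monomial z al = 0.
  move=> ij ali; rewrite /monomial (bigD1 i)//= mxE (negbTE ij).
  by rewrite expr0n (negbTE ali) mul0r.
have mk k : monomial z (mpoly.mnm_muln (mpoly.mnm1 j) k) = t ^+ k.
  rewrite /monomial (bigD1 j)//= big1 ?mulr1 => [|i ij].
    by rewrite mxE eqxx mpoly.mulmnE mpoly.mnm1E eqxx mul1n.
  by rewrite mpoly.mulmnE mpoly.mnm1E eq_sym (negbTE ij) expr0.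
have s1 : series (fun k => `|RtoC (a k)| * `|t| ^+ k) =
    (fun N => \sum_(al : mpoly.bmultinom 2 N) `|RtoC (A al) * monomial z al|).
  apply/funext => N; rewrite (sum_bmultinom (F := fun al => `|RtoC (A al) * monomial z al|)).
    by apply: eq_bigr => k _; rewrite mk normrM normrX.
  by move=> al i ij ali; rewrite (mz al i)// mulr0 normr0.
have s2 : series (fun k => RtoC (a k) * t ^+ k) =
    (fun N => \sum_(al : mpoly.bmultinom 2 N) RtoC (A al) * monomial z al).
  apply/funext => N; rewrite (sum_bmultinom (F := fun al => RtoC (A al) * monomial z al)).
    by apply: eq_bigr => k _; rewrite mk.
  by move=> al i ij ali; rewrite (mz al i)// mulr0.
rewrite s1 s2; split; first exact: h1.
have <- : peval p z = (map_poly (@RtoC R) upoly).[t]; last exact: h2.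
by rewrite peval_upoly mxE eqxx.
Qed.

Hypotheses (p_ge0 : forall al, 0 <= mpoly.mcoeff al p)
  (p_0 : mpoly.mcoeff (@mpoly.mnm0 2) p = 0)
  (p_1 : 0 < mpoly.mcoeff (mpoly.mnm1 j) p).

Lemma upoly_coef k : upoly`_k =
  \sum_(al <- mpoly.msupp p) mpoly.mcoeff al p * (k == al j)%:R.
Proof. by rewrite /upoly coef_sum; apply: eq_bigr => al _; rewrite coefZ coefXn. Qed.

Lemma upoly_nneg : nneg upoly.
Proof. by move=> k; rewrite upoly_coef sumr_ge0// => al _; rewrite mulr_ge0. Qed.

Lemma upoly_coef0 : upoly`_0 = 0.
Proof.
rewrite upoly_coef big_seq big1// => al; rewrite mpoly.mcoeff_msupp => pal.
have [al0|] := eqVneq 0%N (al j); last by rewrite mulr0.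
suff al00 : al = @mpoly.mnm0 2 by rewrite al00 p_0 eqxx in pal.
apply/mpoly.mnmP => i; rewrite mpoly.mnm0E.
by have [->//|ij] := eqVneq i j; exact: (p_j pal ij).
Qed.

Lemma upoly_coef1 : 0 < upoly`_1.
Proof.
rewrite upoly_coef (bigD1_seq (mpoly.mnm1 j)) ?mpoly.msupp_uniq//=.
  by rewrite mpoly.mnm1E eqxx mulr1 ltr_pwDl// sumr_ge0// => al _; rewrite mulr_ge0.
by rewrite mpoly.mcoeff_msupp gt_eqF.
Qed.

End OneVariable.

(** * Coefficient extraction by roots of unity *)

Section RootAverages.
Context {R : realType}.
Local Notation C := (CC R).

(** [X^N - 1] splits over the closed field and is separable in characteristic 0; a set of [N]
    distinct [N]-th roots of unity contains a primitive one. *)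
Lemma prim_root_exists N : (0 < N)%N -> exists w : C, N.-primitive_root w.
Proof.
pose p : {poly C} := 'X^N - 1; have [r Dp] := closed_field_poly_normal p.
move=> N_gt0; rewrite (monicP _) ?monicXnsubC // scale1r in Dp.
have rn1: all N.-unity_root r by apply/allP=> z; rewrite -root_prod_XsubC -Dp.
have sz_r: (N < (size r).+1)%N.
  by rewrite -(size_prod_XsubC r id) -Dp size_XnsubC.
have [|z] := hasP (cyclic.has_prim_root N_gt0 rn1 _ sz_r); last by exists z.
by rewrite -separable.separable_prod_XsubC -Dp cyclotomic.separable_Xn_sub_1 // pnatr_eq0 -lt0n.
Qed.

Lemma prim_root_norm N (w : C) : N.-primitive_root w -> `|w| = 1.
Proof.
move=> wp; have N0 := prim_order_gt0 wp; apply/eqP.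
by rewrite -(pexpr_eq1 N0) ?normr_ge0// -normrX (prim_expr_order wp) normr1.
Qed.

Lemma prim_root_conj N (w : C) : N.-primitive_root w -> w^* = w^-1.
Proof. by move=> /prim_root_norm w1; rewrite [RHS]invC_norm w1 expr1n invr1 mul1r. Qed.

Lemma dist_lim_le (u : nat -> C) (l a e : C) (n0 : nat) :
  u @ \oo --> l -> e \is Num.real ->
  (forall n, (n0 <= n)%N -> `|u n - a| <= e) -> `|l - a| <= e.
Proof.
move=> /cvgrPdist_lt ul e_real une; rewrite real_leNgt ?normr_real//.
apply/negP => lt_e; have [n1 _ ln] := ul _ (eq_ind_r _ lt_e (subr_gt0 _ _)).
pose n := maxn n0 n1.
have : `|l - a| < `|l - a| - e + e.
  apply: le_lt_trans (ler_distD (u n) _ _) _.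
  by rewrite ltr_leD ?une ?leq_maxl//; apply: ln; exact: leq_maxr.
by rewrite subrK ltxx.
Qed.

(** A discrete Cauchy integral, the conjugate of [w] standing for its inverse. Applied to a power
    series it keeps the terms of index congruent to [k] modulo [N], with their powers of [t]. *)
Definition root_avg (N : nat) (w : C) (k : nat) (f : C -> C) (t : C) : C :=
  N%:R^-1 * \sum_(s < N) (w^*) ^+ (s * k) * f (t * w ^+ s).

Lemma root_avg_monomial N w k a i t : N.-primitive_root w ->
  root_avg N w k (fun z => a * z ^+ i) t = if i == k %[mod N] then a * t ^+ i else 0.
Proof.
move=> wp; have N0 := prim_order_gt0 wp.
have N0C : (N%:R : C) != 0 by rewrite pnatr_eq0 -lt0n.
have wk0 : w ^+ k != 0 by rewrite expf_neq0// -normr_eq0 (prim_root_norm wp) oner_eq0.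
pose x := w ^+ i / w ^+ k.
have -> : root_avg N w k (fun z => a * z ^+ i) t =
    N%:R^-1 * (a * t ^+ i * \sum_(s < N) x ^+ s).
  rewrite /root_avg; congr (_ * _); rewrite mulr_sumr; apply: eq_bigr => s _.
  rewrite (prim_root_conj wp) /x expr_div_n exprVn exprMn -!exprM.
  by rewrite (mulnC i s) (mulnC k s); ring.
have x1 : (x == 1) = (i == k %[mod N]).
  by rewrite -(eq_prim_root_expr wp) /x -(inj_eq (mulIf wk0)) divfK// mul1r.
rewrite -x1; case: (eqVneq x 1) => [->|x_neq1].
  by under eq_bigr do rewrite expr1n; rewrite sumr_const card_ord mulrC mulfK.
suff -> : \sum_(s < N) x ^+ s = 0 by rewrite !mulr0.
apply/eqP; have : x ^+ N - 1 == 0.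
  by rewrite /x exprMn exprVn -!exprM !(mulnC _ N) !exprM (prim_expr_order wp) !expr1n invr1 mulr1 subrr.
by rewrite subrX1 mulf_eq0 subr_eq0 (negbTE x_neq1).
Qed.

Lemma root_avg_sum N w k (I : Type) (r : seq I) (f : I -> C -> C) t :
  root_avg N w k (fun z => \sum_(i <- r) f i z) t = \sum_(i <- r) root_avg N w k (f i) t.
Proof.
rewrite /root_avg -mulr_sumr exchange_big /=; congr (_ * _).
by apply: eq_bigr => s _; rewrite mulr_sumr.
Qed.

Lemma root_avgD N w k f g t :
  root_avg N w k (fun z => f z + g z) t = root_avg N w k f t + root_avg N w k g t.
Proof.
rewrite /root_avg -mulrDr -big_split /=; congr (_ * _).
by apply: eq_bigr => s _; rewrite mulrDr.
Qed.

Lemma root_avg_le N w k f t e : N.-primitive_root w ->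
  (forall z, `|z| = `|t| -> `|f z| <= e) -> `|root_avg N w k f t| <= e.
Proof.
move=> wp fe; have N0 := prim_order_gt0 wp; have w1 := prim_root_norm wp.
have N0C : 0 < (N%:R : C) by rewrite ltr0n.
rewrite /root_avg normrM normfV (gtr0_norm N0C) ler_pdivrMl//.
apply: (le_trans (ler_norm_sum _ _ _)).
have -> : N%:R * e = \sum_(s < N) e by rewrite sumr_const card_ord mulr_natl.
apply: ler_sum => s _; rewrite normrM normrX norm_conjC w1 expr1n mul1r.
by apply: fe; rewrite normrM normrX w1 expr1n mulr1.
Qed.

Lemma root_avg_cvg N w k (u : nat -> C -> C) f t : N.-primitive_root w ->
  (forall z, `|z| = `|t| -> u n z @[n --> \oo] --> f z) ->
  root_avg N w k (u n) t @[n --> \oo] --> root_avg N w k f t.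
Proof.
move=> wp uf; have w1 := prim_root_norm wp.
apply: cvgMl_tmp; apply: (@cvg_finsum _ C^o) => s; apply: cvgMl_tmp.
by apply: uf; rewrite normrM normrX w1 expr1n mulr1.
Qed.

(** Once [N] exceeds [k], the surviving terms other than the [k]-th lie in the tail from [N] on. Its
    absolute sum at [rho] bounds the error uniformly in [t] and [w], which is what nested averages
    require. *)
Lemma root_avg_coef (c : nat -> C) (rho : C) (f : C -> C) (k : nat) (e : C) :
  0 <= rho -> 0 < e -> cvgn (series (fun i => `|c i| * rho ^+ i)) ->
  (forall t, `|t| <= rho -> series (fun i => c i * t ^+ i) @ \oo --> f t) ->
  exists N0, forall N w t, (N0 <= N)%N -> N.-primitive_root w -> `|t| <= rho ->
    `|root_avg N w k f t - c k * t ^+ k| <= e.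
Proof.
move=> rho0 e0 ccvg cf.
move/cvg_cauchy/cauchy_seriesP : ccvg => /(_ e e0)[[A B] /= [[nA _ hA] [nB _ hB]] AB].
exists (maxn k.+1 (maxn nA nB)) => N w t; rewrite !geq_max => /and3P[kN AN BN] wp trho.
have tail n : (N <= n)%N -> \sum_(N <= i < n) `|c i| * rho ^+ i <= e.
  move=> Nn; have /ltW := AB (N, n) (conj (hA N AN) (hB n (leq_trans BN Nn))).
  apply: le_trans; apply: real_ler_norm; apply: rpred_sum => i _.
  by rewrite ger0_real// mulr_ge0// exprn_ge0.
apply: (@dist_lim_le (fun n => root_avg N w k (series (fun i z => c i * z ^+ i) n) t) _ _ _ N).
- apply: root_avg_cvg => // z zt.
  have -> : (fun n => series (fun i z => c i * z ^+ i) n z) = series (fun i => c i * z ^+ i).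
    by apply/funext => n; rewrite /series /= fct_sumE.
  by apply: cf; rewrite zt.
- exact: gtr0_real.
move=> n Nn.
have -> : root_avg N w k (series (fun i z => c i * z ^+ i) n) t =
    \sum_(0 <= i < n) (if i == k %[mod N] then c i * t ^+ i else 0).
  rewrite /series /= -(eq_bigr _ (fun i _ => root_avg_monomial k (c i) i t wp)).
  rewrite -root_avg_sum; congr root_avg; apply/funext => z; by rewrite fct_sumE.
rewrite (big_cat_nat (n := N))//=.
have -> : \sum_(0 <= i < N) (if i == k %[mod N] then c i * t ^+ i else 0) = c k * t ^+ k.
  rewrite big_nat (eq_bigr (fun i => if i == k then c i * t ^+ i else 0)).
    by rewrite -big_nat -big_mkcond big_nat1_eq /= kN.
  by move=> i /andP[_ iN]; rewrite !modn_small.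
rewrite addrAC subrr add0r; apply: le_trans (tail n Nn).
apply: (le_trans (ler_norm_sum _ _ _)); apply: ler_sum => i _.
case: ifP => _; last by rewrite normr0 mulr_ge0// exprn_ge0.
by rewrite normrM normrX ler_wpM2l// lerXn2r.
Qed.

End RootAverages.

(** * Identification of the given coefficients and choice of radii *)

Section Coefficients.
Context {R : realType}.
Variables (q : {poly R}) (m : nat) (a : nat -> R) (r : R).
Hypotheses (q0 : nneg q) (q_0 : q`_0 = 0) (q_1 : 0 < q`_1) (r0 : 0 < r).
Hypothesis a_expansion : forall t : CC R, `|t| < RtoC r ->
  cvgn (series (fun k => `|RtoC (a k)| * `|t| ^+ k)) /\
  series (fun k => RtoC (a k) * t ^+ k) @ \oo -->
    (1 - (map_poly (@RtoC R) q).[t]) ^- m.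

Lemma horner_le_lin t : 0 <= t <= 1 -> q.[t] <= t * q.[1].
Proof.
move=> /andP[t0 t1]; rewrite !horner_coef mulr_sumr; apply: ler_sum => -[[|i] ?] _ /=.
  by rewrite q_0 !mul0r mulr0.
rewrite expr1n mulr1 mulrC ler_wpM2r// exprS ler_piMr// exprn_ile1//.
Qed.

Lemma horner_ge_lin t : 0 <= t -> q`_1 * t <= q.[t].
Proof.
move=> t0; apply: le_trans (nneg_horner_le 2 q0 t0).
by rewrite big_nat_recr//= big_nat1 q_0 mul0r add0r expr1.
Qed.

Lemma horner1_gt0 : 0 < q.[1].
Proof. by apply: lt_le_trans (horner_ge_lin ler01); rewrite mulr1. Qed.

Lemma horner_small t : 0 <= t -> t <= (q.[1] + 1)^-1 -> q.[t] < 1.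
Proof.
move=> t0 tq; have q1 := horner1_gt0; have q11 : 0 < q.[1] + 1 by rewrite addr_gt0.
have t1 : t <= 1 by apply: (le_trans tq); rewrite invf_le1// lerDr ltW.
apply: (le_lt_trans (@horner_le_lin t _)); first by rewrite t0.
apply: (@le_lt_trans _ _ ((q.[1] + 1)^-1 * q.[1])); first by rewrite ler_wpM2r// ltW.
by rewrite mulrC ltr_pdivrMr// mul1r ltrDl.
Qed.

Lemma real_expansion t : 0 <= t -> t < r ->
  cvgn (series (fun k => `|a k| * t ^+ k)) /\
  series (fun k => a k * t ^+ k) @ \oo --> (1 - q.[t]) ^- m.
Proof.
move=> t0 tr; have [|h1 h2] := @a_expansion (RtoC t).
  by rewrite normr_RtoC ltr_RtoC ger0_norm.
split.
  apply/is_cvg_RtoC; move: h1.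
  suff -> : series (fun k => `|RtoC (a k)| * `|RtoC t| ^+ k) =
    (fun n => RtoC (series (fun k => `|a k| * t ^+ k) n)) by [].
  apply/funext => n; rewrite /series /= rmorph_sum /=; apply: eq_bigr => k _.
  by rewrite !normr_RtoC (ger0_norm t0) rmorphM rmorphXn.
apply/cvg_seriesRtoC; move: h2; rewrite horner_map /= fmorphV rmorphXn rmorphB rmorph1.
suff -> : (fun k => RtoC (a k) * RtoC t ^+ k) = (fun n => RtoC (a n * t ^+ n)) by [].
by apply/funext => k; rewrite rmorphM rmorphXn.
Qed.

(** Both series have the sum [(1 - q.[t]) ^- m] for small positive [t], so their difference is a
    power series vanishing there. *)
Lemma expansion_coefE k : a k = recip_coef q m k.
Proof.
have q1 : 0 < (q.[1] + 1)^-1 by rewrite invr_gt0 addr_gt0// horner1_gt0.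
(* Below [r] the given series converges absolutely; below [(q.[1] + 1)^-1] one has [q.[t] <= t *
   q.[1] < 1], so the explicit one converges too. *)
pose t0 := Num.min (r / 2) (q.[1] + 1)^-1.
have t0_gt0 : 0 < t0 by rewrite lt_min divr_gt0.
have t0r : t0 < r by rewrite gt_min ltr_pdivrMr// ltr_pMr// ltr1n.
have t0q : t0 <= (q.[1] + 1)^-1 by rewrite ge_min lexx orbT.
apply/eqP; rewrite -subr_eq0; apply/eqP.
apply: (@power_series_eq0 _ (fun k => a k - recip_coef q m k) t0) => //.
  have [h1 _] := real_expansion (ltW t0_gt0) t0r.
  have h2 := recip_coef_series (m := m) q0 q_0 (ltW t0_gt0) (horner_small (ltW t0_gt0) t0q).
  have h3 : cvgn (series (fun k => `|a k| * t0 ^+ k + recip_coef q m k * t0 ^+ k)).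
    by apply: is_cvg_seriesD => //; apply/cvg_ex; eexists; exact: h2.
  apply: series_le_cvg h3 => n.
  - by rewrite mulr_ge0// exprn_ge0// ltW.
  - rewrite addr_ge0// mulr_ge0 ?exprn_ge0// ?(ltW t0_gt0)//.
    by apply: nneg_exp; exact: nneg_geom.
  - rewrite -mulrDl ler_wpM2r ?exprn_ge0 ?(ltW t0_gt0)//.
    apply: (le_trans (ler_normB _ _)); rewrite lerD2l ger0_norm//.
    by apply: nneg_exp; exact: nneg_geom.
move=> t /andP[t_gt0 tt0].
have [_ h1] := real_expansion (ltW t_gt0) (lt_trans tt0 t0r).
have h2 := recip_coef_series (m := m) q0 q_0 (ltW t_gt0) (horner_small (ltW t_gt0) (le_trans (ltW tt0) t0q)).
have h := cvgB h1 h2; rewrite subrr in h.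
suff <- : series (fun k => a k * t ^+ k) - series (fun k => recip_coef q m k * t ^+ k) =
  series (fun k => (a k - recip_coef q m k) * t ^+ k) by exact: h.
apply/funext => n; rewrite /series !fctE /= -sumrB; apply: eq_bigr => i _.
by rewrite mulrBl.
Qed.

Lemma expansion_coef_gt0 k : (0 < m)%N -> 0 < a k.
Proof. by move=> m0; rewrite expansion_coefE recip_coef_gt0. Qed.

Lemma expansion_series t : 0 <= t -> q.[t] < 1 ->
  series (fun k => a k * t ^+ k) @ \oo --> (1 - q.[t]) ^- m.
Proof.
move=> t0 qt; under eq_fun do rewrite expansion_coefE.
exact: recip_coef_series.
Qed.

(* For |v| = s, the arguments u conj v met with u in the domain of the kernel stay
   below rho, inside the disc where the expansion is given. *)
Lemma expansion_radius : exists s0 : R, 0 < s0 /\ forall s, 0 < s -> s <= s0 ->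
  q.[s ^+ 2] < 1 /\ exists rho : R, [/\ 0 <= rho, s ^+ 2 <= rho,
    (forall x, 0 <= x -> q.[x ^+ 2] < 1 -> x * s <= rho),
    cvgn (series (fun k => `|RtoC (a k)| * RtoC rho ^+ k)) &
    forall t : CC R, `|t| <= RtoC rho ->
      series (fun k => RtoC (a k) * t ^+ k) @ \oo -->
        (1 - (map_poly (@RtoC R) q).[t]) ^- m].
Proof.
(* [U] bounds every modulus [x] in the domain: [q_1 x^2 <= q.[x^2] < 1] gives [x^2 <= 1 / q_1], and
   [x] is at most 1 or at most [x^2]. *)
pose U := 1 + (q`_1)^-1; have U1 : 1 <= U by rewrite lerDl invr_ge0 ltW.
have U0 : 0 < U by exact: lt_le_trans U1.
have q1 : 0 < (q.[1] + 1)^-1 by rewrite invr_gt0 addr_gt0// horner1_gt0.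
(* The three bounds give in turn [s^2 <= s], [q.[s^2] < 1], and [rho = s U <= r / 2 < r]. *)
exists (Num.min 1 (Num.min (q.[1] + 1)^-1 (r / 2 / U))); split.
  by rewrite !lt_min ltr01 q1 !divr_gt0.
move=> s s0; rewrite !le_min => /and3P[s1 sq sr].
have ss : s ^+ 2 <= s by rewrite expr2 ger_pMl.
have s2 : 0 <= s ^+ 2 by rewrite exprn_ge0// ltW.
split; first by apply: horner_small => //; exact: le_trans sq.
exists (s * U).
have sU0 : 0 <= s * U by rewrite mulr_ge0 ?ltW.
have sUr : s * U < r.
  by apply: (@le_lt_trans _ _ (r / 2)); rewrite -?ler_pdivlMr// ltr_pdivrMr// ltr_pMr// ltr1n.
split=> //.
- by apply: (le_trans ss); rewrite ler_peMr// ltW.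
- move=> x x0 qx; rewrite mulrC ler_pM2l//.
  have qx2 := le_lt_trans (horner_ge_lin (exprn_ge0 2 x0)) qx.
  have x2 : x ^+ 2 <= (q`_1)^-1 by rewrite -[(q`_1)^-1]mul1r ler_pdivlMr// mulrC ltW.
  have [x1|/ltW x1] := leP x 1; first by rewrite (le_trans x1).
  by rewrite (@le_trans _ _ (x ^+ 2))// ?expr2 ?ler_peMr// -expr2 (le_trans x2)// lerDr.
- have [|h _] := @a_expansion (RtoC (s * U)); first by rewrite normr_RtoC ltr_RtoC ger0_norm.
  by move: h; rewrite normr_RtoC ger0_norm.
- by move=> t tr; apply: (a_expansion _).2; apply: (le_lt_trans tr); rewrite ltr_RtoC.
Qed.

End Coefficients.

(** * A Cauchy criterion in terms of inner products *)

Section CauchyDot.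
Context {R : realType} {H : completeNormedModType (CC R)}.
Variable dot : {dot H for Num.conj}.
Hypothesis dot_norm : inner_product_norm dot.

(* |g n - g n'|^2 is a signed sum of four inner products, which cancel in the limit. *)
Lemma cvg_of_dot (g : nat -> H) (c : CC R) : 0 <= c ->
  (forall e : CC R, 0 < e -> exists n0, forall n n', (n0 <= n)%N ->
    `|dot (g n) (g n') - c| <= e) ->
  cvgn g.
Proof.
move=> c0 gc; apply/cauchy_cvgP/cauchyP => e e0.
(* Four inner products, each within [e^2 / 8] of [c], leave a squared distance of at most
   [e^2 / 2]. *)
have e2 : 0 < e ^+ 2 / 8 by rewrite divr_gt0// exprn_gt0.
have [n0 hn0] := gc _ e2; exists (g n0); exists n0 => // n /= n0n.
rewrite -ball_normE /= -(@ltr_pXn2r _ 2) ?nnegrE ?(ltW e0)// -dot_norm.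
have d1 := hn0 n0 n0 (leqnn _); have d2 := hn0 n0 n (leqnn _).
have d3 := hn0 n n0 n0n; have d4 := hn0 n n n0n.
have -> : dot (g n0 - g n) (g n0 - g n) =
  (dot (g n0) (g n0) - c) - (dot (g n0) (g n) - c) - ((dot (g n) (g n0) - c) - (dot (g n) (g n) - c)).
  by rewrite dotBl !dotBr; ring.
set x := _ - _ in d1 *; set y := _ - _ in d2 *; set z := _ - _ in d3 *; set t := _ - _ in d4 *.
have : 0 <= x - y - (z - t).
  suff -> : x - y - (z - t) = dot (g n0 - g n) (g n0 - g n) by rewrite dot_norm exprn_ge0.
  by rewrite dotBl !dotBr /x /y /z /t; ring.
move=> /ger0_norm <-.
apply: (@le_lt_trans _ _ (e ^+ 2 / 8 + e ^+ 2 / 8 + (e ^+ 2 / 8 + e ^+ 2 / 8))).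
  apply: (le_trans (ler_normB _ _)); apply: lerD.
    by apply: (le_trans (ler_normB _ _)); exact: lerD.
  by apply: (le_trans (ler_normB _ _)); exact: lerD.
have -> : e ^+ 2 / 8 + e ^+ 2 / 8 + (e ^+ 2 / 8 + e ^+ 2 / 8) = e ^+ 2 / 2 by field.
by rewrite ltr_pdivrMr// ltr_pMr ?exprn_gt0// ltr1n.
Qed.

End CauchyDot.

(** * The orthogonal basis of the Hartogs space *)

Section HartogsSpace.
Context {R : realType}.
Local Notation C := (CC R).
Variables (P : 'I_2 -> mpoly.mpoly 2 R) (m : 'I_2 -> nat).
Variable H : rkhs (hartogs_triangle P) (hartogs_kernel P m).
Local Notation dot := (rkhs_dot H).
Local Notation ev := (@rkhs_eval _ _ _ H).
Local Notation D := (hartogs_triangle P).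
Local Notation K := (hartogs_kernel P m).

Variables (q : 'I_2 -> {poly R}) (a : 'I_2 -> nat -> R) (s : R) (rho : 'I_2 -> R).
Local Notation S := (RtoC s).
Definition ker1 (j : 'I_2) (t : C) : C := (1 - (map_poly (@RtoC R) (q j)).[t]) ^- m j.

Hypotheses
 (peval_q : forall j z, peval (P j) z = (map_poly (@RtoC R) (q j)).[z 0 j])
 (a_gt0 : forall j k, 0 < a j k)
 (a_series : forall j t, 0 <= t -> (q j).[t] < 1 ->
    series (fun k => a j k * t ^+ k) @ \oo --> (1 - (q j).[t]) ^- m j)
 (s_gt0 : 0 < s) (q_s : forall j, (q j).[s ^+ 2] < 1)
 (rho_ge0 : forall j, 0 <= rho j) (s_rho : forall j, s ^+ 2 <= rho j)
 (rho_dom : forall j x, 0 <= x -> (q j).[x ^+ 2] < 1 -> x * s <= rho j)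
 (a_cvg : forall j, cvgn (series (fun k => `|RtoC (a j k)| * RtoC (rho j) ^+ k)))
 (a_sum : forall j (t : C), `|t| <= RtoC (rho j) ->
    series (fun k => RtoC (a j k) * t ^+ k) @ \oo --> ker1 j t).

Lemma prod_I2 (F : 'I_2 -> C) : \prod_(j < 2) F j = F 0 * F 1.
Proof.
by rewrite !big_ord_recl big_ord0 mulr1; congr (F _ * F _); apply/val_inj.
Qed.

Lemma I2_case (Q : 'I_2 -> Prop) : Q 0 -> Q 1 -> forall j, Q j.
Proof.
move=> Q0 Q1 [[|[|//]] ji].
- by rewrite (_ : Ordinal ji = 0)//; apply/val_inj.
- by rewrite (_ : Ordinal ji = 1)//; apply/val_inj.
Qed.

Definition modulus (z : 'rV[C]_2) (j : 'I_2) : R := Creal `|phi z 0 j|.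

Lemma RtoC_modulus z j : RtoC (modulus z j) = `|phi z 0 j|.
Proof. exact: CrealK. Qed.

Lemma modulus_ge0 z j : 0 <= modulus z j.
Proof. exact: Creal_ge0. Qed.

Lemma peval_modulus z j :
  peval (P j) (mul_conj (phi z) (phi z)) = RtoC (q j).[modulus z j ^+ 2].
Proof.
by rewrite peval_q mxE -horner_map /= rmorphXn /= RtoC_modulus normCK.
Qed.

Lemma dom_modulus z j : D z -> (q j).[modulus z j ^+ 2] < 1.
Proof. by move=> [_ /(_ j)]; rewrite peval_modulus -(ltr_RtoC _ 1). Qed.

Lemma dom_neq0 z : D z -> z 0 1 != 0.
Proof. by case. Qed.

(** A section of [phi] over nonzero [v2]: it carries a torus in the coordinates [(z1/z2, z2)] back
    to the domain. *)
Definition torus_pt (v1 v2 : C) : 'rV[C]_2 := \row_j (if j == 0 then v1 * v2 else v2).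

Lemma torus_pt1 v1 v2 : torus_pt v1 v2 0 1 = v2.
Proof. by rewrite mxE. Qed.

Lemma phi0 (z : 'rV[C]_2) : phi z 0 0 = z 0 0 / z 0 1.
Proof. by rewrite mxE. Qed.

Lemma phi1 (z : 'rV[C]_2) : phi z 0 1 = z 0 1.
Proof. by rewrite mxE. Qed.

Lemma phi_torus_pt0 (v1 v2 : C) : v2 != 0 -> phi (torus_pt v1 v2) 0 0 = v1.
Proof. by move=> v20; rewrite !mxE /= mulfK. Qed.

Lemma phi_torus_pt1 (v1 v2 : C) : phi (torus_pt v1 v2) 0 1 = v2.
Proof. by rewrite !mxE. Qed.

Lemma dom_torus_pt v1 v2 : `|v1| = S -> `|v2| = S -> D (torus_pt v1 v2).
Proof.
move=> v1s v2s; have v20 : v2 != 0.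
  by rewrite -normr_eq0 v2s RtoC_eq0 gt_eqF.
split; first by rewrite torus_pt1.
move=> j; rewrite peval_modulus -(rmorph1 (@RtoC R)) ltr_RtoC.
suff -> : modulus (torus_pt v1 v2) j = s by [].
apply/RtoC_inj; rewrite RtoC_modulus; move: j; apply: I2_case.
  by rewrite phi_torus_pt0.
by rewrite phi_torus_pt1.
Qed.

Lemma kernelE z w : K z w = (z 0 1 * (w 0 1)^*)^-1 *
  (ker1 0 (phi z 0 0 * (phi w 0 0)^*) * ker1 1 (phi z 0 1 * (phi w 0 1)^*)).
Proof. by rewrite /hartogs_kernel prod_I2 !peval_q !mxE. Qed.

Definition kvec (w : 'rV[C]_2) : H := xget 0 [set kw : H |
  (forall z, D z -> ev kw z = K z w) /\ (forall f, ev f w = dot f kw)].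

Lemma kvecP w : D w ->
  (forall z, D z -> ev (kvec w) z = K z w) /\ (forall f, ev f w = dot f (kvec w)).
Proof.
move=> Dw; have [kw hkw] := rkhs_reproducing H Dw.
exact: (@xgetPex _ 0 [set kw : H |
  (forall z, D z -> ev kw z = K z w) /\ (forall f, ev f w = dot f kw)] (ex_intro _ kw hkw)).
Qed.

Lemma ev_dot f w : D w -> ev f w = dot f (kvec w).
Proof. by move=> /kvecP[]. Qed.

Lemma ev_kvec z w : D z -> D w -> ev (kvec w) z = K z w.
Proof. by move=> Dz /kvecP[+ _]; apply. Qed.

Lemma ev_ext (f g : H) : (forall z, D z -> ev f z = ev g z) -> f = g.
Proof.
move=> fg; apply/eqP; rewrite -subr_eq0; apply/eqP/(@rkhs_eval_inj _ _ _ H) => z Dz.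
by rewrite ev_dot// dotBl -!ev_dot// fg// subrr.
Qed.

Definition unit_root n : C := xget 0 [set w : C | n.+1.-primitive_root w].

Lemma unit_rootP n : n.+1.-primitive_root (unit_root n).
Proof.
have [w wp] := @prim_root_exists R _ (ltn0Sn n).
exact: (@xgetPex _ 0 [set w : C | n.+1.-primitive_root w] (ex_intro _ w wp)).
Qed.

Lemma unit_root_conjP n : n.+1.-primitive_root ((unit_root n)^*).
Proof. by rewrite fmorph_primitive_root unit_rootP. Qed.

Lemma normr_unit_rootX n i : `|S * unit_root n ^+ i| = S.
Proof.
rewrite normrM normrX (prim_root_norm (unit_rootP n)) expr1n mulr1 normr_RtoC.
by rewrite ger0_norm// ltW.
Qed.

(* The factor (S * w ^+ i2)^* cancels the conjugated part of (z2 conj w2)^-1 in the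
   kernel. *)
Definition torus_avg n k l : H :=
  let w := unit_root n in
  (n.+1%:R^-1 * n.+1%:R^-1) *: \sum_(i1 < n.+1) \sum_(i2 < n.+1)
    (w ^+ (i1 * k) * (w ^+ (i2 * l) * (S * w ^+ i2)^*)) *:
      kvec (torus_pt (S * w ^+ i1) (S * w ^+ i2)).

(** Pairing with a kernel vector evaluates [f] at a torus point, where the conjugated weight cancels
    the factor [1 / z2]. For separated variables the double sum then splits. *)
Lemma dot_torus_avg f (F1 F2 : C -> C) n k l :
  (forall z, D z -> ev f z = (z 0 1)^-1 * (F1 (phi z 0 0) * F2 (phi z 0 1))) ->
  dot f (torus_avg n k l) =
    root_avg n.+1 (unit_root n) k F1 S * root_avg n.+1 (unit_root n) l F2 S.
Proof.
move=> fF; rewrite /torus_avg /root_avg; set w := unit_root n.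
have wS i : `|S * w ^+ i| = S by exact: normr_unit_rootX.
have w0 i : S * w ^+ i != 0 by rewrite -normr_eq0 wS RtoC_eq0 gt_eqF.
rewrite dotZr mulrACA; congr (_ * _).
  by rewrite rmorphM /= fmorphV /= conjC_nat.
rewrite big_distrlr /= dot_sumr; apply: eq_bigr => i1 _.
rewrite dot_sumr; apply: eq_bigr => i2 _.
rewrite dotZr -ev_dot; last exact: dom_torus_pt.
rewrite fF; last exact: dom_torus_pt.
rewrite torus_pt1 phi_torus_pt0// phi_torus_pt1.
set v1 := S * w ^+ i1; set v2 := S * w ^+ i2.
have v20 : v2 != 0 by exact: w0.
rewrite 2!rmorphM /= conjCK !rmorphXn /=; clearbody v1 v2.
by field.
Qed.

(** The kernel depends on the conjugate of its second argument, whence the averages over powers of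
    the conjugate root. *)
Lemma ev_torus_avg n k l z : D z -> ev (torus_avg n k l) z =
  (z 0 1)^-1 * (root_avg n.+1 (unit_root n)^* k (ker1 0) (phi z 0 0 * S) *
                root_avg n.+1 (unit_root n)^* l (ker1 1) (phi z 0 1 * S)).
Proof.
move=> Dz; rewrite ev_dot// /torus_avg /root_avg; set w := unit_root n.
have wS i : `|S * w ^+ i| = S by exact: normr_unit_rootX.
have w0 i : S * w ^+ i != 0 by rewrite -normr_eq0 wS RtoC_eq0 gt_eqF.
rewrite dotZl [X in _ = _ * X]mulrACA [RHS]mulrCA; congr (_ * _).
rewrite big_distrlr /= dot_suml mulr_sumr; apply: eq_bigr => i1 _.
rewrite dot_suml mulr_sumr; apply: eq_bigr => i2 _.
have Dt := dom_torus_pt (wS i1) (wS i2).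
rewrite dotZl -ev_dot// ev_kvec// kernelE torus_pt1 phi_torus_pt0// phi_torus_pt1.
have cS i : (S * w ^+ i)^* = S * w^* ^+ i by rewrite rmorphM /= conjC_RtoC rmorphXn.
have cw0 i : S * w^* ^+ i != 0 by rewrite -cS conjC_eq0.
rewrite !cS !mulrA conjCK.
set A := ker1 0 _; set B := ker1 1 _.
have z0 := dom_neq0 Dz; have := cw0 i2; set v := S * w^* ^+ i2 => v0.
move: v0; rewrite /v mulf_eq0 negb_or => /andP[S0 wi0].
by field; apply/and3P; split.
Qed.

(** The inner average is [a_k (v S)^k] up to an error uniform in [v], and the outer one reproduces
    this monomial exactly for every [n']. The threshold therefore concerns [n] alone, the form used
    by [cvg_of_dot]. *)
Lemma avg_est j k (e : C) : 0 < e -> exists n0, forall n n', (n0 <= n)%N ->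
  `|root_avg n'.+1 (unit_root n') k
      (fun v => root_avg n.+1 (unit_root n)^* k (ker1 j) (v * S)) S
    - RtoC (a j k) * S ^+ k * S ^+ k| <= e.
Proof.
move=> e0.
have rho0 : 0 <= RtoC (rho j) by rewrite RtoC_ge0.
have [n0 hn0] := root_avg_coef k rho0 e0 (@a_cvg j) (@a_sum j).
exists n0 => n n' n0n.
have -> : (fun v => root_avg n.+1 (unit_root n)^* k (ker1 j) (v * S)) =
  (fun v => RtoC (a j k) * S ^+ k * v ^+ k +
    (root_avg n.+1 (unit_root n)^* k (ker1 j) (v * S) - RtoC (a j k) * (v * S) ^+ k)).
  by apply/funext => v; rewrite exprMn; ring.
rewrite root_avgD root_avg_monomial ?eqxx; last exact: unit_rootP.
rewrite addrAC subrr add0r; apply: root_avg_le; first exact: unit_rootP.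
move=> v vS; apply: hn0; [exact: leqW | exact: unit_root_conjP |].
rewrite normrM vS normr_RtoC ger0_norm ?(ltW s_gt0)// -rmorphM ler_RtoC.
exact: s_rho.
Qed.

Lemma mul_est (x y u v e : C) : 0 < e ->
  let d := e / (`|u| + `|v| + 1 + e) in
  `|x - u| <= d -> `|y - v| <= d -> `|x * y - u * v| <= e.
Proof.
move=> e0 d xu yv; set t := `|u| + `|v| + 1.
have t0 : 0 < t by rewrite ltr_wpDl// addr_ge0.
have te0 : 0 < t + e by rewrite addr_gt0.
have d0 : 0 < d by rewrite divr_gt0.
(* The summand [e] in the denominator of [d] ensures this, so that the quadratic error
   [(x - u) (y - v)] is at most [d]. *)
have d1 : d <= 1 by rewrite ler_pdivrMr// mul1r lerDr ltW.
have -> : x * y - u * v = (x - u) * (y - v) + u * (y - v) + (x - u) * v by ring.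
apply: (@le_trans _ _ (d * 1 + `|u| * d + d * `|v|)).
  apply: (le_trans (ler_normD _ _)); apply: lerD; last first.
    by rewrite normrM ler_wpM2r.
  apply: (le_trans (ler_normD _ _)); apply: lerD.
    by rewrite normrM ler_pM// (le_trans yv).
  by rewrite normrM ler_wpM2l.
have -> : d * 1 + `|u| * d + d * `|v| = d * t by rewrite /t; ring.
by rewrite /d mulrAC ler_pdivrMr// ler_pM2l// lerDl ltW.
Qed.

Lemma dot_torus_avg_est k l (e : C) : 0 < e -> exists n0, forall n n', (n0 <= n)%N ->
  `|dot (torus_avg n k l) (torus_avg n' k l) -
     (RtoC (a 0 k) * S ^+ k * S ^+ k) * (RtoC (a 1 l) * S ^+ l * S ^+ l)| <= e.
Proof.
move=> e0; set u := _ * _ * S ^+ k; set v := _ * _ * S ^+ l.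
pose d := e / (`|u| + `|v| + 1 + e).
have d0 : 0 < d by rewrite divr_gt0// addr_gt0// ltr_wpDl// addr_ge0.
have [n1 h1] := avg_est 0 k d0; have [n2 h2] := avg_est 1 l d0.
exists (maxn n1 n2) => n n'; rewrite geq_max => /andP[n1n n2n].
rewrite (@dot_torus_avg _ (fun v => root_avg n.+1 (unit_root n)^* k (ker1 0) (v * S))
  (fun v => root_avg n.+1 (unit_root n)^* l (ker1 1) (v * S)) n' k l (@ev_torus_avg n k l)).
by apply: mul_est => //; [exact: h1 | exact: h2].
Qed.

Lemma torus_avg_cvg k l : cvgn (fun n => torus_avg n k l).
Proof.
apply: (cvg_of_dot (@rkhs_norm _ _ _ H)); last exact: dot_torus_avg_est.
by rewrite !mulr_ge0 ?exprn_ge0 ?RtoC_ge0// ltW.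
Qed.

Lemma root_avg_ker1_cvg j k (t : C) : `|t| <= RtoC (rho j) ->
  root_avg n.+1 (unit_root n)^* k (ker1 j) t @[n --> \oo] --> RtoC (a j k) * t ^+ k.
Proof.
move=> trho; apply/cvgrPdist_le => e e0.
have rho0 : 0 <= RtoC (rho j) by rewrite RtoC_ge0.
have [n0 hn0] := root_avg_coef k rho0 e0 (@a_cvg j) (@a_sum j).
exists n0 => // n /= n0n; rewrite distrC.
by apply: hn0 => //; [exact: leqW | exact: unit_root_conjP].
Qed.

(** The function [f_kl] of the overview. The limit of the averages is [f_kl] times its two
    coefficients and [S ^+ (k + l)], the latter coming from base points of modulus [s]. *)
Definition mono k l : H :=
  (RtoC (a 0 k) * RtoC (a 1 l) * S ^+ (k + l))^-1 *: limn (fun n => torus_avg n k l).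

Lemma phi_le_rho z j : D z -> `|phi z 0 j * S| <= RtoC (rho j).
Proof.
move=> Dz; rewrite normrM -RtoC_modulus normr_RtoC (ger0_norm (ltW s_gt0)) -rmorphM ler_RtoC.
by apply: rho_dom; [exact: modulus_ge0 | exact: dom_modulus].
Qed.

Lemma ev_mono k l z : D z ->
  ev (mono k l) z = (z 0 1)^-1 * (phi z 0 0 ^+ k * phi z 0 1 ^+ l).
Proof.
move=> Dz; rewrite ev_dot// dotZl.
have l1 := cvg_dotl (@rkhs_norm _ _ _ H) (g := kvec z) (torus_avg_cvg (k := k) (l := l)).
have l2 : dot (torus_avg n k l) (kvec z) @[n --> \oo] -->
    (z 0 1)^-1 * (RtoC (a 0 k) * (phi z 0 0 * S) ^+ k *
                  (RtoC (a 1 l) * (phi z 0 1 * S) ^+ l)).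
  under eq_fun do rewrite -ev_dot// ev_torus_avg//.
  apply: cvgMl_tmp; apply: cvgM; apply: root_avg_ker1_cvg; exact: phi_le_rho.
rewrite (cvgC_unique (l1 _) l2) !exprMn exprD.
have S0 : S != 0 by rewrite RtoC_eq0 gt_eqF.
have A0 j i : RtoC (a j i) != 0 by rewrite RtoC_eq0 gt_eqF.
have z0 := dom_neq0 Dz.
by field; rewrite z0 !A0 !expf_neq0.
Qed.

Lemma dot_mono k l k' l' : dot (mono k l) (mono k' l') =
  if (k == k') && (l == l') then RtoC (a 0 k * a 1 l)^-1 else 0.
Proof.
have S0 : S != 0 by rewrite RtoC_eq0 gt_eqF.
have A0 j i : RtoC (a j i) != 0 by rewrite RtoC_eq0 gt_eqF.
rewrite [in mono k' l']/mono dotZr.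
have l1 := cvg_dotr (@rkhs_norm _ _ _ H) (g := mono k l) (torus_avg_cvg (k := k') (l := l')).
have l2 : dot (mono k l) (torus_avg n k' l') @[n --> \oo] -->
    (if (k == k') && (l == l') then S ^+ (k + l) else 0).
  (* Once [n] exceeds all four indices, congruence modulo [n + 1] is equality, so the averages of a
     monomial are exact and the sequence is eventually constant. *)
  apply: cvg_near_cst; exists (k + k' + (l + l'))%N => // n /= nk.
  rewrite (@dot_torus_avg (mono k l) (fun v => 1 * v ^+ k) (fun v => 1 * v ^+ l)); last first.
    by move=> z Dz; rewrite ev_mono// !mul1r.
  rewrite !root_avg_monomial; try exact: unit_rootP.
  rewrite !modn_small; try by rewrite ltnS; apply: leq_trans nk; lia.
  by case: eqP => _; case: eqP => _ /=; rewrite ?mul0r ?mulr0// !mul1r exprD.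
rewrite (cvgC_unique (l1 _) l2).
case: ifP => [/andP[/eqP <- /eqP <-]|_]; last by rewrite mulr0.
rewrite fmorphV !rmorphM /= rmorphXn /= !conjC_RtoC fmorphV rmorphM.
by field; rewrite !A0 expf_neq0.
Qed.

Lemma mono_complete f : (forall k l, dot f (mono k l) = 0) -> f = 0.
Proof.
move=> f0; apply: ev_ext => z Dz; rewrite [RHS]ev_dot// dot0l.
have z0 := dom_neq0 Dz.
pose x k l := ev (mono k l) z.
pose T n : H := \sum_(0 <= k < n) \sum_(0 <= l < n)
  (RtoC (a 0 k * a 1 l) * (x k l)^*) *: mono k l.
pose t j := modulus z j ^+ 2.
pose s1 n := series (fun k => a 0 k * t 0 ^+ k) n.
pose s2 n := series (fun k => a 1 k * t 1 ^+ k) n.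
have tE j : RtoC (t j) = `|phi z 0 j| ^+ 2 by rewrite rmorphXn /= RtoC_modulus.
have x_sqr k l : `|x k l| ^+ 2 = `|z 0 1| ^- 2 * RtoC (t 0 ^+ k * t 1 ^+ l).
  rewrite /x ev_mono// !normrM !normrX normfV rmorphM /= [RtoC (t 0 ^+ k)]rmorphXn [RtoC (t 1 ^+ l)]rmorphXn /= !tE.
  by rewrite !exprMn exprVn -!exprM !muln2 -!addnn !exprD.
have TfE f' n : dot f' (T n) =
  \sum_(0 <= k < n) \sum_(0 <= l < n) RtoC (a 0 k * a 1 l) * x k l * dot f' (mono k l).
  rewrite dot_sumr; apply: eq_bigr => k _; rewrite dot_sumr; apply: eq_bigr => l _.
  by rewrite dotZr rmorphM /= conjC_RtoC conjCK.
have Tm n k l : (k < n)%N -> (l < n)%N -> dot (T n) (mono k l) = (x k l)^*.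
  move=> kn ln; rewrite dot_suml big_mkord (bigD1 (Ordinal kn))//= dot_suml.
  rewrite big_mkord (bigD1 (Ordinal ln))//= dotZl dot_mono !eqxx /=.
  rewrite big1 ?addr0 => [|i /negbTE il]; last first.
    by rewrite dotZl dot_mono eqxx /= (_ : nat_of_ord i == l = false) ?mulr0.
  rewrite big1 ?addr0 => [|i /negbTE ik]; last first.
    rewrite dot_suml big1// => l' _.
    by rewrite dotZl dot_mono (_ : nat_of_ord i == k = false) ?mulr0.
  by rewrite mulrAC fmorphV mulfV ?mul1r// RtoC_eq0 gt_eqF// mulr_gt0.
have Tnorm n : dot (T n) (T n) = `|z 0 1| ^- 2 * RtoC (s1 n * s2 n).
  rewrite TfE /s1 /s2 /series /= big_distrlr /= rmorph_sum mulr_sumr.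
  rewrite [LHS]big_nat [RHS]big_nat; apply: eq_bigr => k /andP[_ kn].
  rewrite rmorph_sum mulr_sumr [LHS]big_nat [RHS]big_nat; apply: eq_bigr => l /andP[_ ln].
  rewrite Tm// -mulrA -normCK x_sqr mulrCA -rmorphM /=; congr (_ * RtoC _).
  by ring.
(* [T n] is the projection of the kernel vector on finitely many [mono k l]; hence the squared
   distance is [K z z - |T n|^2], a difference of nonnegative series to which [a_series] applies at
   every point of the domain. *)
have Tz n : dot (T n) (kvec z) = dot (T n) (T n).
  rewrite [RHS]TfE dot_suml [LHS]big_nat [RHS]big_nat; apply: eq_bigr => k /andP[_ kn].
  rewrite dot_suml [LHS]big_nat [RHS]big_nat; apply: eq_bigr => l /andP[_ ln].
  by rewrite dotZl Tm// -ev_dot// -mulrA [_^* * _]mulrC mulrA.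
have zT n : dot (kvec z) (T n) = dot (T n) (T n).
  rewrite dotC Tz geC0_conj// (@rkhs_norm _ _ _ H) exprn_ge0//.
have zz : dot (kvec z) (kvec z) = `|z 0 1| ^- 2 *
    RtoC ((1 - (q 0).[t 0]) ^- m 0 * (1 - (q 1).[t 1]) ^- m 1).
  rewrite -ev_dot// ev_kvec// kernelE -!normCK; congr (_ * _).
  rewrite rmorphM /ker1 -!tE.
  by congr (_ * _); rewrite horner_map fmorphV rmorphXn rmorphB rmorph1.
have dist n : `|kvec z - T n| ^+ 2 = `|z 0 1| ^- 2 *
   RtoC ((1 - (q 0).[t 0]) ^- m 0 * (1 - (q 1).[t 1]) ^- m 1 - s1 n * s2 n).
  rewrite -(@rkhs_norm _ _ _ H) dotBl !dotBr Tz zT subrr subr0 zz Tnorm.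
  by rewrite -mulrBr -rmorphB.
have dist0 : `|kvec z - T n| ^+ 2 @[n --> \oo] --> (0 : C).
  under eq_fun do rewrite dist.
  rewrite -(mulr0 (`|z 0 1| ^- 2)); apply: cvgMl_tmp; rewrite -(rmorph0 (@RtoC R)).
  apply/cvg_RtoC; rewrite -(subrr ((1 - (q 0).[t 0]) ^- m 0 * (1 - (q 1).[t 1]) ^- m 1)).
  apply: cvgB; first exact: cvg_cst.
  by apply: cvgM; apply: a_series; rewrite ?exprn_ge0 ?modulus_ge0 ?dom_modulus.
have fz n : `|dot f (kvec z)| ^+ 2 <= `|f| ^+ 2 * `|kvec z - T n| ^+ 2.
  have -> : dot f (kvec z) = dot f (kvec z - T n).
    rewrite dotBr TfE big1 ?subr0// => k _; rewrite big1// => l _.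
    by rewrite f0 mulr0.
  by rewrite -exprMn lerXn2r ?nnegrE ?mulr_ge0// (cauchy_schwarz (@rkhs_norm _ _ _ H)).
rewrite ev_dot//; apply/eqP; rewrite -normr_eq0 -sqrf_eq0.
have l0 : `|f| ^+ 2 * `|kvec z - T n| ^+ 2 @[n --> \oo] --> (0 : C).
  by rewrite -(mulr0 (`|f| ^+ 2)); apply: cvgMl_tmp.
apply: contraT => d0; have /cvgrPdist_lt := l0.
move=> /(_ (`|dot f (kvec z)| ^+ 2)); rewrite lt_def d0 exprn_ge0//= => /(_ isT)[n _ hn].
have := hn n (leqnn n); rewrite /= sub0r normrN ger0_norm ?mulr_ge0 ?exprn_ge0//.
by move=> /(le_lt_trans (fz n)); rewrite ltxx.
Qed.

End HartogsSpace.

(* The sequence shifted by one, with the convention u(-1) = 0. *)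
Definition prev {R : realType} (u : nat -> R) k : R := if k is k'.+1 then u k' else 0.

Lemma sum_prev {R : realType} (u : nat -> R) n :
  \sum_(0 <= k < n) (u k - prev u k) = prev u n.
Proof.
elim: n => [|n IH]; first by rewrite big_geq.
by rewrite big_nat_recr//= IH addrC subrK.
Qed.

Lemma nat2_bij : exists b : nat -> nat * nat, bijective b.
Proof.
have /card_set_bijP[b] : ([set: nat] #= [set: nat * nat])%card.
  by apply: card_esym; exact: card_nat2.
by rewrite setTT_bijective => bb; exists b.
Qed.

(** * The determinant operator *)

Section WeightedShifts.
Context {R : realType} {H : completeNormedModType (CC R)}.
Variable dot : {dot H for Num.conj}.
Hypothesis dot_norm : inner_product_norm dot.
Variables (al be : nat -> R) (mono : nat -> nat -> H) (M1 M2 : H -> H).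
Hypotheses (al_gt0 : forall k, 0 < al k) (be_gt0 : forall l, 0 < be l)
  (dot_mono : forall k l k' l', dot (mono k l) (mono k' l') =
     if (k == k') && (l == l') then RtoC (al k * be l)^-1 else 0)
  (mono_complete : forall f, (forall k l, dot f (mono k l) = 0) -> f = 0)
  (bM1 : bounded_op M1) (bM2 : bounded_op M2)
  (M1_mono : forall k l, M1 (mono k l) = mono k.+1 l.+1)
  (M2_mono : forall k l, M2 (mono k l) = mono k l.+1).

Local Notation x := (fun k => al k / al k.+1).
Local Notation y := (fun l => be l / be l.+1).
Local Notation M1s := (adjoint dot M1).
Local Notation M2s := (adjoint dot M2).

Lemma ratio_gt0 (u : nat -> R) k : (forall i, 0 < u i) -> 0 < u k / u k.+1.
Proof. by move=> u0; rewrite divr_gt0. Qed.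

Lemma mono_ext f g : (forall k l, dot f (mono k l) = dot g (mono k l)) -> f = g.
Proof.
move=> fg; apply/eqP; rewrite -subr_eq0; apply/eqP/mono_complete => k l.
by rewrite dotBl fg subrr.
Qed.

(** The results on adjoints and diagonal operators use bases indexed by [nat], so the pairs are
    enumerated by an arbitrary bijection. *)
Lemma onb_mono (b : nat -> nat * nat) : bijective b ->
  orthonormal_basis dot (fun n =>
    RtoC (Num.sqrt (al (b n).1 * be (b n).2)) *: mono (b n).1 (b n).2).
Proof.
move=> [b' bK b'K]; have ab k l : 0 < al k * be l by rewrite mulr_gt0.
split=> [i j|f f0].
  rewrite dotZl dotZr dot_mono conjC_RtoC.
  have -> : ((b i).1 == (b j).1) && ((b i).2 == (b j).2) = (i == j).
    rewrite -[i == j](inj_eq (can_inj bK)); by case: (b i) (b j) => [? ?] [? ?].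
  case: eqVneq => [->|_]; last by rewrite !mulr0.
  rewrite -!rmorphM /= mulrA -expr2 sqr_sqrtr ?ltW// mulfV ?rmorph1//.
  by rewrite gt_eqF.
apply: mono_complete => k l; have := f0 (b' (k, l)); rewrite b'K dotZr conjC_RtoC.
by move=> /eqP; rewrite mulf_eq0 RtoC_eq0 gt_eqF ?sqrtr_gt0//= => /eqP.
Qed.

Lemma adj1 : is_adjoint dot M1 M1s.
Proof.
have [b bb] := nat2_bij; have [e_on e_c] := onb_mono bb.
exact: (adjointP dot_norm e_on e_c bM1).
Qed.

Lemma adj2 : is_adjoint dot M2 M2s.
Proof.
have [b bb] := nat2_bij; have [e_on e_c] := onb_mono bb.
exact: (adjointP dot_norm e_on e_c bM2).
Qed.

Lemma bM1s : bounded_op M1s.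
Proof.
have [b bb] := nat2_bij; have [e_on e_c] := onb_mono bb.
exact: (bounded_adjoint dot_norm e_on e_c bM1).
Qed.

Lemma bM2s : bounded_op M2s.
Proof.
have [b bb] := nat2_bij; have [e_on e_c] := onb_mono bb.
exact: (bounded_adjoint dot_norm e_on e_c bM2).
Qed.

(** The weight is the quotient of the squared norms of [mono k l] and its predecessor. At [k = 0] or
    [l = 0] the convention of [prev] supplies the factor 0, making the truncated index harmless. *)
Lemma M1s_mono k l : M1s (mono k l) = RtoC (prev x k * prev y l) *: mono k.-1 l.-1.
Proof.
apply: mono_ext => i j; rewrite dotC -adj1 M1_mono dotZl !dot_mono.
have n0 u n : (forall i, 0 < u i) -> u n != 0 :> R by move=> u0; rewrite gt_eqF.
case: k => [|k] /=; first by rewrite mul0r rmorph0 mul0r ?conjC0.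
case: l => [|l] /=; first by rewrite andbF mulr0 rmorph0 mul0r ?conjC0.
rewrite !eqSS (eq_sym i) (eq_sym j); case: ifP => [/andP[/eqP <- /eqP <-]|_].
  rewrite conjC_RtoC -rmorphM /=; congr RtoC.
  by field; rewrite !n0.
by rewrite conjC0 mulr0.
Qed.

Lemma M2s_mono k l : M2s (mono k l) = RtoC (prev y l) *: mono k l.-1.
Proof.
apply: mono_ext => i j; rewrite dotC -adj2 M2_mono dotZl !dot_mono.
have n0 u n : (forall i, 0 < u i) -> u n != 0 :> R by move=> u0; rewrite gt_eqF.
case: l => [|l] /=; first by rewrite andbF rmorph0 mul0r ?conjC0.
rewrite !eqSS (eq_sym i) (eq_sym j); case: ifP => [/andP[/eqP <- /eqP <-]|_].
  rewrite conjC_RtoC -rmorphM /=; congr RtoC.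
  by field; rewrite !n0.
by rewrite conjC0 mulr0.
Qed.

Lemma prev_mono (u : nat -> R) k l : RtoC (prev u l) *: mono k l.-1.+1 = RtoC (prev u l) *: mono k l.
Proof. by case: l => //=; rewrite rmorph0 !scale0r. Qed.

Lemma commutator11 k l : commutator M1s M1 (mono k l) =
  RtoC (x k * y l - prev x k * prev y l) *: mono k l.
Proof.
rewrite /commutator /= M1_mono !M1s_mono /= linZ; last by case: bM1.
rewrite M1_mono rmorphB scalerBl; congr (_ - _).
by case: k l => [|k] [|l] //=; rewrite ?mul0r ?mulr0 rmorph0 !scale0r.
Qed.

Lemma commutator22 k l : commutator M2s M2 (mono k l) =
  RtoC (y l - prev y l) *: mono k l.
Proof.
rewrite /commutator /= M2_mono !M2s_mono /= linZ; last by case: bM2.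
by rewrite M2_mono rmorphB scalerBl prev_mono.
Qed.

(** The two mixed commutators move the first index in opposite directions; only their products are
    diagonal. *)
Lemma commutator12 k l : commutator M1s M2 (mono k l) =
  RtoC (prev x k * (y l - prev y l)) *: mono k.-1 l.
Proof.
rewrite /commutator /= M2_mono !M1s_mono /= linZ; last by case: bM2.
rewrite M2_mono mulrBr rmorphB scalerBl; congr (_ - _).
by case: l => //=; rewrite mulr0 rmorph0 !scale0r.
Qed.

Lemma commutator21 k l : commutator M2s M1 (mono k l) =
  RtoC (y l - prev y l) *: mono k.+1 l.
Proof.
rewrite /commutator /= M1_mono !M2s_mono /= linZ; last by case: bM1.
by rewrite M1_mono rmorphB scalerBl prev_mono.
Qed.

Lemma bounded_commutator (S T : H -> H) : bounded_op S -> bounded_op T ->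
  bounded_op (commutator S T).
Proof. by move=> bS bT; apply: bounded_opB; exact: bounded_op_comp. Qed.

Definition det_weight k l : R := (x k - prev x k) * (y l ^+ 2 - prev y l ^+ 2).

Lemma bounded_det : bounded_op (det_op dot M1 M2).
Proof.
have c11 := bounded_commutator bM1s bM1; have c22 := bounded_commutator bM2s bM2.
have c12 := bounded_commutator bM1s bM2; have c21 := bounded_commutator bM2s bM1.
exact: (bounded_opB (bounded_opB (bounded_opD (bounded_op_comp c11 c22)
  (bounded_op_comp c22 c11)) (bounded_op_comp c12 c21)) (bounded_op_comp c21 c12)).
Qed.

Lemma det_mono k l : det_op dot M1 M2 (mono k l) = RtoC (det_weight k l) *: mono k l.
Proof.
have [b1 b2] := (bM1s, bM2s).
have lc (S T : H -> H) (c : CC R) f : bounded_op S -> bounded_op T ->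
    commutator S T (c *: f) = c *: commutator S T f.
  by move=> bS bT; rewrite linZ//; case: (bounded_commutator bS bT).
rewrite /det_op /= commutator22 commutator11 commutator21 commutator12.
rewrite !lc// commutator22 commutator11 commutator21 commutator12 /= !scalerA.
rewrite -!rmorphM /=.
have -> : RtoC (prev x k * (y l - prev y l) * (y l - prev y l)) *: mono k.-1.+1 l =
    RtoC (prev x k * (y l - prev y l) * (y l - prev y l)) *: mono k l.
  by case: k => //=; rewrite !mul0r rmorph0 !scale0r.
rewrite -!scalerDl -!scalerBl -!rmorphD -!rmorphB; congr (RtoC _ *: _).
(* With [x'], [y'] the previous values: [2 (x y - x' y') (y - y') - (x + x') (y - y')^2 = (x - x')
   (y^2 - y'^2)]. *)
by rewrite /det_weight; ring.
Qed.

(** At [l = 0] the second factor is the positive [y_0^2], which isolates the increments of [x]; at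
    [k = 0] the first is [x_0], which isolates those of [y^2]. *)
Lemma det_weight_ge0 : (forall k l, 0 <= det_weight k l) <->
  nondecreasing_seq x /\ nondecreasing_seq y.
Proof.
have x0 k := ratio_gt0 k al_gt0; have y0 l := ratio_gt0 l be_gt0.
rewrite -!nondecreasing_seqP; split=> [w0|[xn yn] k l].
  split=> n.
    have := w0 n.+1 0%N; rewrite /det_weight /= expr0n subr0 pmulr_lge0 ?exprn_gt0//.
    by rewrite subr_ge0.
  have := w0 0%N n.+1; rewrite /det_weight /= subr0 pmulr_rge0// subr_ge0.
  by rewrite ler_pXn2r// ?nnegrE ltW.
rewrite mulr_ge0// subr_ge0.
  by case: k => [|k]; [exact: ltW | exact: xn].
case: l => [|l] /=; first by rewrite expr0n exprn_ge0// ltW.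
by rewrite ler_pXn2r// ?nnegrE ?(ltW (y0 _))//; exact: yn.
Qed.

Lemma det_positive : positive_op dot (det_op dot M1 M2) <->
  nondecreasing_seq x /\ nondecreasing_seq y.
Proof.
have [b bb] := nat2_bij; rewrite -det_weight_ge0.
pose d n := det_weight (b n).1 (b n).2.
have De n : det_op dot M1 M2 (RtoC (Num.sqrt (al (b n).1 * be (b n).2)) *: mono (b n).1 (b n).2) =
  RtoC (d n) *: (RtoC (Num.sqrt (al (b n).1 * be (b n).2)) *: mono (b n).1 (b n).2).
  by rewrite linZ ?det_mono 1?scalerA 1?mulrC -?scalerA//; case: bounded_det.
rewrite (diag_positive dot_norm (onb_mono bb) bounded_det De).
split=> [d0 k l|w0 n]; last exact: w0.
by have [b' _ b'K] := bb; have := d0 (b' (k, l)); rewrite /d b'K.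
Qed.

(** On [mono k l] the operators multiply squared norms by [x k * y l] and [y l]; for [x] one fixes
    [l = 0] and divides by [y_0]. *)
Lemma ratio_bounded : bounded_fun x /\ bounded_fun y.
Proof.
have x0 k := ratio_gt0 k al_gt0; have y0 l := ratio_gt0 l be_gt0.
have bd (u : nat -> R) (B : R) : (forall k, 0 < u k) -> (forall k, u k <= B) -> bounded_fun u.
  move=> u0 uB; exists B; split; first exact: num_real.
  by move=> M BM k _ /=; rewrite ger0_norm ?(ltW (u0 k))// (le_trans (uB k))// ltW.
have mono_norm k l : `|mono k l| ^+ 2 = RtoC (al k * be l)^-1.
  by rewrite -dot_norm dot_mono !eqxx.
have sqB T B k l k' l' : 0 <= B -> (forall f, `|T f| <= B * `|f|) ->
   T (mono k l) = mono k' l' -> (al k * be l) / (al k' * be l') <= Creal B ^+ 2.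
  move=> B0 TB Tm; have := TB (mono k l); rewrite Tm.
  rewrite -(@ler_pXn2r _ 2) ?nnegrE ?mulr_ge0// exprMn !mono_norm -{1}(CrealK B0).
  rewrite -rmorphXn -rmorphM /= ler_RtoC => h.
  by rewrite mulrC -ler_pdivlMr// mulr_gt0.
split.
- have [_ [B B0 hB]] := bounded_opP bM1.
  apply: (bd x (Creal B ^+ 2 / y 0%N)) => // k.
  rewrite ler_pdivlMr//; apply: le_trans (sqB M1 B k 0%N k.+1 1%N B0 hB (M1_mono _ _)).
  by rewrite mulf_div.
- have [_ [B B0 hB]] := bounded_opP bM2.
  apply: (bd y (Creal B ^+ 2)) => // l.
  apply: le_trans (sqB M2 B 0%N l 0%N l.+1 B0 hB (M2_mono _ _)).
  by rewrite -mulf_div mulfV ?mul1r// gt_eqF.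
Qed.

Lemma det_trace : nondecreasing_seq x -> nondecreasing_seq y ->
  is_trace dot (det_op dot M1 M2) (RtoC (limn x * (limn y) ^+ 2)).
Proof.
move=> xn yn; have [b bb] := nat2_bij.
have [bx bY] := ratio_bounded.
have w0 : forall k l, 0 <= det_weight k l by apply/det_weight_ge0.
have xc : x @ \oo --> limn x.
  by apply: nondecreasing_is_cvgn => //; exact: bounded_fun_has_ubound.
have yc : y @ \oo --> limn y.
  by apply: nondecreasing_is_cvgn => //; exact: bounded_fun_has_ubound.
pose d n := det_weight (b n).1 (b n).2.
have De n : det_op dot M1 M2 (RtoC (Num.sqrt (al (b n).1 * be (b n).2)) *: mono (b n).1 (b n).2) =
  RtoC (d n) *: (RtoC (Num.sqrt (al (b n).1 * be (b n).2)) *: mono (b n).1 (b n).2).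
  by rewrite linZ ?det_mono 1?scalerA 1?mulrC -?scalerA//; case: bounded_det.
apply: (diag_trace dot_norm (onb_mono bb) bounded_det De).
  by move=> n; exact: w0.
apply: (cvg_double_series w0 bb).
(* The sum over a square is a product of two one-variable sums, each of which telescopes. *)
have -> : (fun n => \sum_(0 <= k < n) \sum_(0 <= l < n) det_weight k l) =
    (fun n => prev x n * prev y n ^+ 2).
  apply/funext => n; rewrite -(sum_prev x) -big_distrlr /=; congr (_ * _).
  have -> : prev y n ^+ 2 = prev (fun l => y l ^+ 2) n by case: n => //=; rewrite expr0n.
  by rewrite -sum_prev; apply: eq_bigr => -[|l] _ //=; rewrite expr0n.
rewrite -cvg_shiftS /=; apply: cvgM => //.
exact: (continuous_cvg _ (@exprn_continuous R 2 _)).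
Qed.

End WeightedShifts.

Unset Implicit Arguments.
Set Strict Implicit.
Set Printing Implicit Defensive.

Theorem proposition5p6 (R : realType) (P : 'I_2 -> mpoly.mpoly 2 R)
    (m : 'I_2 -> nat) (A : 'I_2 -> mindex -> R)
    (H : rkhs (hartogs_triangle P) (hartogs_kernel P m)) (M1 M2 : H -> H) :
  admissible P ->
  (forall j, (0 < m j)%N) ->
  (forall j, is_expansion (P j) (m j) (A j)) ->
  is_multiplication_op (fun z => z 0 0) M1 ->
  is_multiplication_op (fun z => z 0 1) M2 ->
  let a1 := coef_ratio 0 (A 0) in
  let a2 := coef_ratio 1 (A 1) in
  let det := det_op (rkhs_dot H) M1 M2 in
  [/\ positive_op (rkhs_dot H) det <->
        nondecreasing_seq a1 /\ nondecreasing_seq a2,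
      positive_op (rkhs_dot H) det ->
        (trace_class (rkhs_dot H) det <-> bounded_fun a1 /\ bounded_fun a2) &
      bounded_fun a1 -> bounded_fun a2 ->
        nondecreasing_seq a1 -> nondecreasing_seq a2 ->
        is_trace (rkhs_dot H) det (RtoC (limn a1 * (limn a2) ^+ 2))].
Proof.
move=> adm m_gt0 expA [bM1 evM1] [bM2 evM2] a1 a2 det.
pose a j k := A j (mpoly.mnm_muln (mpoly.mnm1 j) k).
pose q j := upoly j (P j).
have Pj j al i : mpoly.mcoeff al (P j) != 0 -> i != j -> al i = 0%N.
  by have [_ _ _ _] := adm j; apply.
have q_nneg j : nneg (q j) by have [h _ _ _ _] := adm j; exact: upoly_nneg.
have q_0 j : (q j)`_0 = 0.
  by have [_ h _ _ _] := adm j; apply: upoly_coef0 => //; exact: Pj.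
have q_1 j : 0 < (q j)`_1 by have [h _ h1 _ _] := adm j; exact: upoly_coef1.
have peval_q j z : peval (P j) z = (map_poly (@RtoC R) (q j)).[z 0 j].
  by apply: peval_upoly; exact: Pj.
have /choice[r /all_and2[r_gt0 a_exp]] : forall j, exists r : R, 0 < r /\
    forall t : CC R, `|t| < RtoC r ->
    cvgn (series (fun k => `|RtoC (a j k)| * `|t| ^+ k)) /\
    series (fun k => RtoC (a j k) * t ^+ k) @ \oo -->
      (1 - (map_poly (@RtoC R) (q j)).[t]) ^- m j.
  move=> j; have [r r0 hr] := univariate_expansion (@Pj j) (expA j).
  by exists r.
have a_gt0 j k : 0 < a j k.
  exact: (expansion_coef_gt0 (q_nneg j) (q_0 j) (q_1 j) (r_gt0 j) (a_exp j)).
have a_series j t (t0 : 0 <= t) (qt : (q j).[t] < 1) :=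
  expansion_series (q_nneg j) (q_0 j) (q_1 j) (r_gt0 j) (a_exp j) t0 qt.
have /choice[s0 /all_and2[s0_gt0 hs0]] j :=
  expansion_radius (q_nneg j) (q_0 j) (q_1 j) (r_gt0 j) (a_exp j).
(* A single torus radius has to serve both coordinates. *)
pose s := Num.min (s0 0) (s0 1).
have s_gt0 : 0 < s by rewrite lt_min !s0_gt0.
have s_le j : s <= s0 j.
  by move: j; apply: I2_case; rewrite /s ge_min lexx ?orbT.
have q_s j : (q j).[s ^+ 2] < 1 := (hs0 j s s_gt0 (s_le j)).1.
have /choice[rho hrho] j := (hs0 j s s_gt0 (s_le j)).2.
have rho_ge0 j : 0 <= rho j by have [] := hrho j.
have s_rho j : s ^+ 2 <= rho j by have [] := hrho j.
have rho_dom j x : 0 <= x -> (q j).[x ^+ 2] < 1 -> x * s <= rho j.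
  by have [_ _ h _ _] := hrho j; exact: h.
have a_cvg j : cvgn (series (fun k => `|RtoC (a j k)| * RtoC (rho j) ^+ k)).
  by have [_ _ _ h _] := hrho j.
have a_sum j (t : CC R) : `|t| <= RtoC (rho j) ->
    series (fun k => RtoC (a j k) * t ^+ k) @ \oo --> ker1 m q j t.
  by have [_ _ _ _ h] := hrho j; exact: h.
pose e := mono H a s.
have ev_e := ev_mono H peval_q a_gt0 s_gt0 q_s rho_ge0 s_rho rho_dom a_cvg a_sum.
have dot_e := dot_mono H peval_q a_gt0 s_gt0 q_s rho_ge0 s_rho rho_dom a_cvg a_sum.
have e_c := mono_complete (H := H) peval_q a_gt0 a_series s_gt0 q_s rho_ge0 s_rho rho_dom a_cvg a_sum.
have M1e k l : M1 (e k l) = e k.+1 l.+1.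
  apply: ev_ext => z Dz; rewrite evM1// !ev_e// !phi0 !phi1.
  have z0 := dom_neq0 Dz; rewrite !exprS.
  by field.
have M2e k l : M2 (e k l) = e k l.+1.
  apply: ev_ext => z Dz; rewrite evM2// !ev_e// !phi0 !phi1 !exprS.
  by have z0 := dom_neq0 Dz; field.
have posE := det_positive (@rkhs_norm _ _ _ H) (a_gt0 0) (a_gt0 1) dot_e e_c bM1 bM2 M1e M2e.
have bd := ratio_bounded (@rkhs_norm _ _ _ H) (a_gt0 0) (a_gt0 1) dot_e bM1 bM2 M1e M2e.
have tr := det_trace (@rkhs_norm _ _ _ H) (a_gt0 0) (a_gt0 1) dot_e e_c bM1 bM2 M1e M2e.
split; [exact: posE | | by move=> _ _; exact: tr].
(* Positivity gives monotonicity; boundedness then holds by [bd] and the trace class property by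
   [tr], so each direction is immediate. *)
by move=> /posE[n1 n2]; split=> // _; have [] := tr n1 n2.
Qed.
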